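(* Let $H$, $H'$ be finite-dimensional Hopf algebras over a field $\Bbbk$, and let $\mathcal F: H\text{-}\mathbf{mod}_{\mathsf{fin}}\to H'\text{-}\mathbf{mod}_{\mathsf{fin}}$ be an equivalence of ($\Bbbk$-linear) tensor categories between their categories of finite-dimensional modules. Then $$\gamma(V)=\gamma(\mathcal F(V))$$ for all absolutely simple $V\in H\text{-}\mathbf{mod}_{\mathsf{fin}}$.
   Context: Let $H$ be a finite-dimensional Hopf algebra over $\Bbbk$ with antipode $S$. For a finite-dimensional left $H$-module $V$, $V^\vee$ denotes its left dual, i.e. $V^*=\operatorname{Hom}_\Bbbk(V,\Bbbk)$ with action $(hf)(v)=f(S(h)v)$. If $V$ is self-dual, i.e. $V\cong V^\vee$ as $H$-modules, then $S(\operatorname{ann}V)=\operatorname{ann}V$ (where $\operatorname{ann} V$ is the annihilator of $V$ in $H$), so $S$ induces an algebra anti-automorphism $S_V$ of $H/\operatorname{ann}V$, $S_V(h+\operatorname{ann}V)=S(h)+\operatorname{ann}V$. A module is absolutely simple if it is simple and remains simple after every extension of the base field. For absolutely simple $V$ define $\gamma(V)=\operatorname{Tr}(S_V)$ if $V\cong V^\vee$, and $\gamma(V)=0$ otherwise. For $H'$ the invariant $\gamma$ is defined in the same way using the antipode of $H'$. *)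

(* Defs.v *)
From HB Require Import structures.
From mathcomp Require Import all_boot all_order all_algebra all_field.
From mathcomp Require Import boolp.

Set Implicit Arguments.
Unset Strict Implicit.
Unset Printing Implicit Defensive.

Import GRing.Theory.
Local Open Scope ring_scope.

Section LinearFunctions.
Context {k : fieldType}.
Implicit Types U V W : vectType k.

Definition mklin U V (f : U -> V) (fL : linear f) : 'Hom(U, V) :=
  linfun (HB.pack_for {linear U -> V} f
    (GRing.isSemilinear.Build k U V _ f (GRing.semilinear_linear fL))).

Lemma mklinE U V (f : U -> V) (fL : linear f) : mklin fL =1 f.
Proof. by move=> u; rewrite lfunE. Qed.

Lemma linfunZ U V (f : U -> V) : linear f -> forall a u, f (a *: u) = a *: f u.
Proof. by move=> fL a u; rewrite -(mklinE fL) linearZ /= mklinE. Qed.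

Lemma linfun_sum U V (f : U -> V) : linear f ->
  forall (I : finType) (F : I -> U), f (\sum_i F i) = \sum_i f (F i).
Proof.
move=> fL I F.
have: mklin fL (\sum_i F i) = \sum_i mklin fL (F i) by rewrite linear_sum.
by rewrite mklinE => ->; apply: eq_bigr => i _; exact: mklinE.
Qed.

Definition bvec V (i : 'I_(\dim {:V})) : V := (vbasis {:V})`_i.
Definition bcoord V (i : 'I_(\dim {:V})) (v : V) : k :=
  coord (vbasis {:V}) i v.

Lemma bcoord_linear V i : scalar (@bcoord V i).
Proof. by move=> a u v; rewrite /bcoord linearP. Qed.

Lemma bcoord_sum V (v : V) : v = \sum_i bcoord i v *: bvec i.
Proof. exact: coord_vbasis (memvf v). Qed.

Lemma bcoord_bvec V (i j : 'I_(\dim {:V})) :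
  bcoord j (bvec i) = (i == j)%:R.
Proof.
by rewrite /bcoord /bvec coord_free ?(basis_free (vbasisP _)) // eq_sym.
Qed.

Definition lfun_trace V (f : 'End(V)) : k :=
  \tr (passmx.mxof (vbasis {:V}) (vbasis {:V}) f).

End LinearFunctions.

(* A vector space U (x) V with explicit coordinates: the (i, j) entry is the
   coefficient of bvec i (x) bvec j. Its universal property is given by tlift,
   tliftE and tens_ext below. *)
Definition tens (k : fieldType) (U V : vectType k) : Type :=
  'M[k]_(\dim {:U}, \dim {:V}).
HB.instance Definition _ (k : fieldType) (U V : vectType k) :=
  Vector.on (tens U V).

Section Tensor.
Context {k : fieldType}.
Implicit Types U V W : vectType k.

Definition pure U V (u : U) (v : V) : tens U V :=
  \matrix_(i, j) (bcoord i u * bcoord j v).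
Local Notation "u ⊗ v" := (pure u v) (at level 40, left associativity).

Definition bilinear_fun U V W (f : U -> V -> W) : Prop :=
  (forall u, linear (f u)) /\ (forall v, linear (f^~ v)).

Lemma pure_bilinear U V : bilinear_fun (@pure U V).
Proof.
split=> [u|v] a x y; apply/matrixP=> i j; rewrite !mxE bcoord_linear.
  by rewrite mulrDr mulrCA.
by rewrite mulrDl mulrA.
Qed.

Lemma pureDZl U V a (x y : U) (v : V) :
  (a *: x + y) ⊗ v = a *: (x ⊗ v) + y ⊗ v.
Proof. by rewrite (proj2 (pure_bilinear U V)). Qed.

Lemma pureDZr U V (u : U) a (x y : V) :
  u ⊗ (a *: x + y) = a *: (u ⊗ x) + u ⊗ y.
Proof. by rewrite (proj1 (pure_bilinear U V)). Qed.

Lemma tens_sum U V (t : tens U V) :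
  t = \sum_i \sum_j t i j *: (bvec i ⊗ bvec j).
Proof.
rewrite [t in LHS](matrix_sum_delta t); apply: eq_bigr => i _.
apply: eq_bigr => j _; congr (_ *: _); apply/matrixP=> p q.
by rewrite !mxE !bcoord_bvec -natrM mulnb eq_sym [j == q]eq_sym.
Qed.

Definition tlift_fun U V W (f : U -> V -> W) (t : tens U V) : W :=
  \sum_i \sum_j t i j *: f (bvec i) (bvec j).

Lemma tlift_fun_linear U V W (f : U -> V -> W) : linear (tlift_fun f).
Proof.
move=> a s t; rewrite /tlift_fun scaler_sumr -big_split; apply: eq_bigr => i _.
rewrite scaler_sumr -big_split; apply: eq_bigr => j _ /=.
by rewrite !mxE scalerDl scalerA.
Qed.

Definition tlift U V W (f : U -> V -> W) : 'Hom(tens U V, W) :=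
  mklin (tlift_fun_linear f).

Lemma tens_fun_ext U V W (f g : tens U V -> W) : linear f -> linear g ->
  (forall u v, f (u ⊗ v) = g (u ⊗ v)) -> f =1 g.
Proof.
move=> fL gL fg t; rewrite [t]tens_sum (linfun_sum fL) (linfun_sum gL).
apply: eq_bigr => i _; rewrite (linfun_sum fL) (linfun_sum gL).
by apply: eq_bigr => j _; rewrite (linfunZ fL) (linfunZ gL) fg.
Qed.

Lemma tens_ext U V W (f g : 'Hom(tens U V, W)) :
  (forall u v, f (u ⊗ v) = g (u ⊗ v)) -> f = g.
Proof.
by move=> fg; apply/lfunP; apply: tens_fun_ext => // a x y; rewrite linearP.
Qed.

Lemma tliftE U V W (f : U -> V -> W) : bilinear_fun f ->
  forall u v, tlift f (u ⊗ v) = f u v.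
Proof.
case=> f2 f1 u v; rewrite mklinE /tlift_fun.
rewrite [u in RHS]bcoord_sum (linfun_sum (f1 v)); apply: eq_bigr => i _.
rewrite (linfunZ (f1 v)) [v in RHS]bcoord_sum (linfun_sum (f2 _)) scaler_sumr.
by apply: eq_bigr => j _; rewrite (linfunZ (f2 _)) scalerA mxE.
Qed.

Lemma tlift_eq U V W (f g : U -> V -> W) :
  (forall u v, f u v = g u v) -> tlift f = tlift g.
Proof.
move=> fg; apply/lfunP=> t; rewrite !mklinE; apply: eq_bigr => i _.
by apply: eq_bigr => j _; rewrite fg.
Qed.

Lemma tlift_lin U V W (h f g : U -> V -> W) a :
  (forall u v, h u v = a *: f u v + g u v) ->
  forall t, tlift h t = a *: tlift f t + tlift g t.
Proof.
move=> E t; rewrite !mklinE /tlift_fun scaler_sumr -big_split.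
apply: eq_bigr => i _; rewrite scaler_sumr -big_split; apply: eq_bigr => j _ /=.
by rewrite E scalerDr !scalerA mulrC.
Qed.

Lemma tlift_comp U V W W' (f : U -> V -> W) (L : W -> W') : linear L ->
  forall t, L (tlift f t) = tlift (fun u v => L (f u v)) t.
Proof.
move=> LL t; rewrite !mklinE (linfun_sum LL); apply: eq_bigr => i _.
by rewrite (linfun_sum LL); apply: eq_bigr => j _; rewrite (linfunZ LL).
Qed.

Definition tmap U U' V V' (f : 'Hom(U, U')) (g : 'Hom(V, V')) :
    'Hom(tens U V, tens U' V') :=
  tlift (fun u v => f u ⊗ g v).

Lemma tmapE U U' V V' (f : 'Hom(U, U')) (g : 'Hom(V, V')) u v :
  tmap f g (u ⊗ v) = f u ⊗ g v.
Proof.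
rewrite tliftE //; split=> w a x y.
  by rewrite linearP pureDZr.
by rewrite linearP pureDZl.
Qed.

Definition tassoc U V W : 'Hom(tens (tens U V) W, tens U (tens V W)) :=
  tlift (fun t w => tlift (fun u v => u ⊗ (v ⊗ w)) t).

Lemma tassocE U V W (u : U) (v : V) (w : W) :
  tassoc U V W (u ⊗ v ⊗ w) = u ⊗ (v ⊗ w).
Proof.
have B w' : bilinear_fun (fun (u : U) (v : V) => u ⊗ (v ⊗ w')).
  by split=> x a y z; rewrite ?pureDZl // pureDZr.
rewrite tliftE ?tliftE //; split=> x a y z; last by rewrite linearP.
by apply: tlift_lin => u' v'; rewrite !pureDZr.
Qed.

Definition tlunit V : 'Hom(tens k^o V, V) :=
  tlift (fun (c : k^o) v => (c : k) *: v).
Definition trunit V : 'Hom(tens V k^o, V) :=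
  tlift (fun v (c : k^o) => (c : k) *: v).

Lemma tlunitE V (c : k^o) (v : V) : tlunit V (c ⊗ v) = (c : k) *: v.
Proof.
rewrite tliftE //; split=> x a y z.
  by rewrite scalerDr !scalerA mulrC.
by rewrite scalerDl scalerA.
Qed.

Lemma trunitE V (v : V) (c : k^o) : trunit V (v ⊗ c) = (c : k) *: v.
Proof.
rewrite tliftE //; split=> x a y z.
  by rewrite scalerDl scalerA.
by rewrite scalerDr !scalerA mulrC.
Qed.

End Tensor.
Notation "u ⊗ v" := (pure u v) (at level 40, left associativity) : ring_scope.

(* The multiplication of A (x) B:  (a (x) b) (a' (x) b') = aa' (x) bb'. *)
Definition tmul (k : fieldType) (A B : falgType k) (s t : tens A B) : tens A B :=
  tlift (fun a b => tlift (fun a' b' => (a * a') ⊗ (b * b')) t) s.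

Lemma tmulE (k : fieldType) (A B : falgType k) (a a' : A) (b b' : B) :
  tmul (a ⊗ b) (a' ⊗ b') = (a * a') ⊗ (b * b').
Proof.
have P x y : bilinear_fun (fun (a' : A) (b' : B) => (x * a') ⊗ (y * b')).
  split=> z c u v; first by rewrite mulrDr -scalerAr pureDZr.
  by rewrite mulrDr -scalerAr pureDZl.
rewrite /tmul tliftE ?tliftE //; split=> z c u v; apply: tlift_lin => x y.
  by rewrite mulrDl -scalerAl pureDZr.
by rewrite mulrDl -scalerAl pureDZl.
Qed.

Record hopfAlg (k : fieldType) := HopfAlg {
  hopf_sort :> falgType k;
  comul : 'Hom(hopf_sort, tens hopf_sort hopf_sort);
  counit : 'Hom(hopf_sort, k^o);
  antipode : 'End(hopf_sort);
  comulA : (tassoc hopf_sort hopf_sort hopf_sort \o (tmap comul \1 \o comul)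
              = tmap \1 comul \o comul)%VF;
  counitl : (tlunit hopf_sort \o (tmap counit \1 \o comul) = \1)%VF;
  counitr : (trunit hopf_sort \o (tmap \1 counit \o comul) = \1)%VF;
  comul1 : comul 1 = 1 ⊗ 1;
  comulM : forall a b, comul (a * b) = tmul (comul a) (comul b);
  counit1 : counit 1 = 1;
  counitM : forall a b, counit (a * b) = counit a * counit b;
  antipodel : forall a,
    tlift (fun x y => antipode x * y) (comul a) = (counit a : k) *: 1;
  antipoder : forall a,
    tlift (fun x y => x * antipode y) (comul a) = (counit a : k) *: 1
}.
Arguments comul {k} h.
Arguments counit {k} h.
Arguments antipode {k} h.

Section HopfTheory.
Context {k : fieldType} (H : hopfAlg k).
Local Notation D := (comul H).
Local Notation e := (counit H).
Local Notation S := (antipode H).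

Lemma comulA3 (W : vectType k) (g : H -> H -> H -> W) (a : H) :
  (forall y z, linear (fun x => g x y z)) ->
  (forall x z, linear (fun y => g x y z)) ->
  (forall x y, linear (fun z => g x y z)) ->
  tlift (fun x z => tlift (fun x y => g x y z) (D x)) (D a) =
  tlift (fun x y => tlift (fun y z => g x y z) (D y)) (D a).
Proof.
move=> g1 g2 g3.
pose G := tlift (fun x (t : tens H H) => tlift (fun y z => g x y z) t).
have GE x y z : G (x ⊗ (y ⊗ z)) = g x y z.
  rewrite /G tliftE ?tliftE //; split=> // u c v w; first by rewrite linearP.
  by apply: tlift_lin => p q; rewrite g1.
have /lfunP/(_ a) := comulA H; rewrite !comp_lfunE => /(congr1 G).
have EL s : G (tassoc H H H (tmap D \1%VF s)) =
    tlift (fun x z => tlift (fun x y => g x y z) (D x)) s.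
  apply: (tens_fun_ext (f := fun s => G (tassoc H H H (tmap D \1%VF s))))=> [c x y|c x y|u v].
  - by rewrite !linearP.
  - by rewrite linearP.
  rewrite tmapE id_lfunE tliftE; last first.
    split=> w c x y; last by rewrite !linearP.
    by apply: tlift_lin => p q; rewrite g3.
  move: (D u); apply: tens_fun_ext => [c x y|c x y|x y].
  - by rewrite pureDZl !linearP.
  - by rewrite linearP.
  by rewrite tassocE GE tliftE.
have ER s : G (tmap \1%VF D s) =
    tlift (fun x y => tlift (fun y z => g x y z) (D y)) s.
  apply: (tens_fun_ext (f := fun s => G (tmap \1%VF D s)))=> [c x y|c x y|u v].
  - by rewrite !linearP.
  - by rewrite linearP.
  rewrite tmapE id_lfunE tliftE; last first.
    split=> w c x y; first by rewrite !linearP.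
    by apply: tlift_lin => p q; rewrite g1.
  move: (D v); apply: tens_fun_ext => [c x y|c x y|x y].
  - by rewrite pureDZr !linearP.
  - by rewrite linearP.
  by rewrite GE tliftE.
by rewrite EL ER.
Qed.

Lemma counitlE (W : vectType k) (f : H -> W) (a : H) : linear f ->
  tlift (fun x y => (e x : k) *: f y) (D a) = f a.
Proof.
move=> fL; have /lfunP/(_ a) := counitl H; rewrite !comp_lfunE id_lfunE.
move=> {2}<-; move: (D a); apply: tens_fun_ext => [c x y|c x y|x y].
- by rewrite linearP.
- by rewrite !linearP fL.
rewrite tmapE tlunitE id_lfunE tliftE.
  by rewrite (linfunZ fL).
split=> z c u v; first by rewrite fL scalerDr !scalerA mulrC.
by rewrite linearP scalerDl scalerA.
Qed.

Lemma counitrE (W : vectType k) (f : H -> W) (a : H) : linear f ->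
  tlift (fun x y => (e y : k) *: f x) (D a) = f a.
Proof.
move=> fL; have /lfunP/(_ a) := counitr H; rewrite !comp_lfunE id_lfunE.
move=> {2}<-; move: (D a); apply: tens_fun_ext => [c x y|c x y|x y].
- by rewrite linearP.
- by rewrite !linearP fL.
rewrite tmapE trunitE id_lfunE tliftE.
  by rewrite (linfunZ fL).
split=> z c u v; first by rewrite linearP scalerDl scalerA.
by rewrite fL scalerDr !scalerA mulrC.
Qed.

Lemma antipode1 : S 1 = 1.
Proof.
have:= antipodel (1 : H); rewrite comul1 tliftE ?mulr1 ?counit1 ?scale1r //.
by split=> z c u v; rewrite ?linearP ?mulrDr ?mulrDl -?scalerAr -?scalerAl.
Qed.

Lemma antipodeM (a b : H) : S (a * b) = S b * S a.
Proof.
have ml (x : H) : linear (fun y => x * y).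
  by move=> c u v; rewrite mulrDr -scalerAr.
have mr (x : H) : linear (fun y => y * x).
  by move=> c u v; rewrite mulrDl -scalerAl.
(* S(ab) = S(a1 b1) a2 b2 S(b3) S(a3) in Sweedler notation *)
pose g (x1 x2 x3 y1 y2 y3 : H) := S (x1 * y1) * (x2 * y2 * (S y3 * S x3)).
have gx1 x2 x3 y1 y2 y3 : linear (fun x1 => g x1 x2 x3 y1 y2 y3).
  by move=> c u v; rewrite /g mr linearP mr.
have gx2 x1 x3 y1 y2 y3 : linear (fun x2 => g x1 x2 x3 y1 y2 y3).
  by move=> c u v; rewrite /g !mr ml.
have gx3 x1 x2 y1 y2 y3 : linear (fun x3 => g x1 x2 x3 y1 y2 y3).
  by move=> c u v; rewrite /g linearP !ml.
have gy1 x1 x2 x3 y2 y3 : linear (fun y1 => g x1 x2 x3 y1 y2 y3).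
  by move=> c u v; rewrite /g ml linearP mr.
have gy2 x1 x2 x3 y1 y3 : linear (fun y2 => g x1 x2 x3 y1 y2 y3).
  by move=> c u v; rewrite /g ml mr ml.
have gy3 x1 x2 x3 y1 y2 : linear (fun y3 => g x1 x2 x3 y1 y2 y3).
  by move=> c u v; rewrite /g linearP mr !ml.
pose inL x1 x2 x3 :=
  tlift (fun y1 y3 => tlift (fun y1 y2 => g x1 x2 x3 y1 y2 y3) (D y1)) (D b).
pose inR x1 x2 x3 :=
  tlift (fun y1 y2 => tlift (fun y2 y3 => g x1 x2 x3 y1 y2 y3) (D y2)) (D b).
have inE x1 x2 x3 : inL x1 x2 x3 = inR x1 x2 x3 by apply: comulA3.
have outE : tlift (fun x z => tlift (fun x y => inL x y z) (D x)) (D a) =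
            tlift (fun x y => tlift (fun y z => inL x y z) (D y)) (D a).
  apply: comulA3 => [x2 x3|x1 x3|x1 x2] c u v; apply: tlift_lin => ? ?;
  by apply: tlift_lin => ? ?; rewrite ?gx1 ?gx2 ?gx3.
transitivity (tlift (fun x y => tlift (fun y z => inL x y z) (D y)) (D a)).
  rewrite -(counitrE (f := fun a => S (a * b))); last first.
    by move=> c u v; rewrite mr linearP.
  congr (fun_of_lfun _ _); apply: tlift_eq => x1 x2.
  transitivity (tlift (fun y z => tlift (fun y1 y2 =>
      (e y2 : k) *: (S (x1 * y1) * (y * S z))) (D b)) (D x2)).
    transitivity (S (x1 * b) * tlift (fun y z => y * S z) (D x2)).
      by rewrite antipoder -scalerAr mulr1.
    rewrite tlift_comp //; congr (fun_of_lfun _ _); apply: tlift_eq => y z.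
    rewrite (counitrE (f := fun y1 => S (x1 * y1) * (y * S z))) //.
    by move=> c u v; rewrite ml linearP mr.
  congr (fun_of_lfun _ _); apply: tlift_eq => y z.
  rewrite inE /inR; congr (fun_of_lfun _ _); apply: tlift_eq => y1 y2.
  transitivity (S (x1 * y1) * (y * (tlift (fun p q => p * S q) (D y2) * S z))).
    by rewrite antipoder -scalerAl mul1r -!scalerAr.
  rewrite (tlift_comp _ (L := fun t => S (x1 * y1) * (y * (t * S z)))).
    by congr (fun_of_lfun _ _); apply: tlift_eq => p q; rewrite /g !mulrA.
  by move=> c u v; rewrite mr !ml.
rewrite -outE.
transitivity (tlift (fun x z => (e x : k) *: (S b * S z)) (D a)); last first.
  rewrite (counitlE (f := fun z => S b * S z)) // => c u v.
  by rewrite linearP ml.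
congr (fun_of_lfun _ _); apply: tlift_eq => x z.
transitivity (tlift (fun y1 y3 => (e (x * y1) : k) *: (S y3 * S z)) (D b)).
  rewrite /inL.
  transitivity (tlift (fun y1 y3 => tlift (fun x1 x2 => tlift (fun y1 y2 =>
      g x1 x2 z y1 y2 y3) (D y1)) (D x)) (D b)).
    move: (D b); apply: tens_fun_ext => [c s t|c s t|u v].
    - by apply: tlift_lin => p q; rewrite !linearP.
    - by rewrite !linearP.
    rewrite tliftE.
      congr (fun_of_lfun _ _); apply: tlift_eq => p q.
      rewrite tliftE //; split=> w c s t; last by rewrite !linearP.
      by apply: tlift_lin => ? ?; rewrite gy3.
    split=> w c s t; apply: tlift_lin => ? ?; last by rewrite !linearP.
    by apply: tlift_lin => ? ?; rewrite gy3.
  congr (fun_of_lfun _ _); apply: tlift_eq => y1 y3.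
  rewrite -[_ * S z]mul1r scalerAl -antipodel comulM.
  rewrite (tlift_comp _ (L := fun t => t * (S y3 * S z))) // /tmul.
  set F := tlift (fun u v => S u * v * (S y3 * S z)).
  rewrite (tlift_comp _ (L := F)); last by move=> c u v; rewrite linearP.
  congr (fun_of_lfun _ _); apply: tlift_eq => p q.
  rewrite (tlift_comp _ (L := F)); last by move=> c u v; rewrite linearP.
  congr (fun_of_lfun _ _); apply: tlift_eq => r s.
  rewrite /F tliftE /g ?mulrA //.
  by split=> w c u v; rewrite ?linearP ?ml ?mr ?linearP ?ml ?mr.
transitivity ((e x : k) *: tlift (fun y1 y3 => (e y1 : k) *: (S y3 * S z)) (D b)).
  rewrite (tlift_comp _ (L := fun t => (e x : k) *: t)).
    congr (fun_of_lfun _ _); apply: tlift_eq => p q.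
    by rewrite counitM scalerA.
  by move=> c u v; rewrite scalerDr !scalerA mulrC.
rewrite (counitlE (f := fun y => S y * S z)) // => c u v.
by rewrite linearP mr.
Qed.

End HopfTheory.

Record fdmod (k : fieldType) (A : falgType k) := FdMod {
  fdmod_sort :> vectType k;
  act : 'Hom(A, 'End(fdmod_sort));
  act1 : act 1 = \1%VF;
  actM : forall a b, act (a * b) = (act a \o act b)%VF
}.
Arguments act {k A} f.

Section Modules.
Context {k : fieldType} {A : falgType k}.
Implicit Types V W X : fdmod A.

Definition ann V : {vspace A} := lker (act V).

Definition submodule V (U : {vspace V}) : Prop :=
  forall a, (act V a @: U <= U)%VS.

Definition simple_mod V : Prop :=
  (fullv : {vspace V}) <> 0%VS /\
  forall U : {vspace V}, submodule U -> U = 0%VS \/ U = fullv.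

Record modhom V W := ModHom {
  hom_lfun :> 'Hom(V, W);
  homP : forall a, (hom_lfun \o act V a = act W a \o hom_lfun)%VF
}.

Lemma modhom_eq V W (f g : modhom V W) : hom_lfun f = hom_lfun g -> f = g.
Proof.
case: f g => [f fP] [g gP] /= E; case: g / E in gP *.
by congr ModHom; exact: Prop_irrelevance.
Qed.

Lemma modhomE V W (f : modhom V W) a v : f (act V a v) = act W a (f v).
Proof. by have /lfunP/(_ v) := homP f a; rewrite !comp_lfunE. Qed.

Lemma modhom_subproof V W (f : 'Hom(V, W)) :
  (forall a v, f (act V a v) = act W a (f v)) ->
  forall a, (f \o act V a = act W a \o f)%VF.
Proof. by move=> fP a; apply/lfunP=> v; rewrite !comp_lfunE fP. Qed.

Lemma hom_id_subproof V a : (\1 \o act V a = act V a \o \1)%VF.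
Proof. by rewrite comp_lfun1l comp_lfun1r. Qed.
Definition hom_id V : modhom V V := ModHom (@hom_id_subproof V).

Lemma hom_comp_subproof V W X (g : modhom W X) (f : modhom V W) a :
  ((g \o f) \o act V a = act X a \o (g \o f))%VF.
Proof. by rewrite -comp_lfunA homP comp_lfunA homP comp_lfunA. Qed.
Definition hom_comp V W X (g : modhom W X) (f : modhom V W) : modhom V X :=
  ModHom (hom_comp_subproof g f).

Lemma hom_lincomb_subproof V W (c : k) (f g : modhom V W) a :
  ((c *: hom_lfun f + g) \o act V a = act W a \o (c *: hom_lfun f + g))%VF.
Proof.
apply: (modhom_subproof (f := c *: hom_lfun f + hom_lfun g)) => b v.
by rewrite !add_lfunE !scale_lfunE !modhomE linearP.
Qed.
Definition hom_lincomb V W (c : k) (f g : modhom V W) : modhom V W :=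
  ModHom (hom_lincomb_subproof c f g).

Definition is_iso V W (f : modhom V W) : Prop :=
  exists g : modhom W V, hom_comp g f = hom_id V /\ hom_comp f g = hom_id W.

Definition isomorphic V W : Prop := exists f : modhom V W, is_iso f.

End Modules.

(* The scalar extension K (x)_k V along iota : k -> K, in the K-basis
   1 (x) bvec i; ext_in v is 1 (x) v, and ext_lift is the universal property. *)
Definition ext (k K : fieldType) (iota : {rmorphism k -> K}) (V : vectType k)
  : Type := 'rV[K]_(\dim {:V}).
HB.instance Definition _ (k K : fieldType) (iota : {rmorphism k -> K})
  (V : vectType k) := Vector.on (ext iota V).

Section ScalarExtension.
Context {k K : fieldType} (iota : {rmorphism k -> K}).
Implicit Types U V : vectType k.
Implicit Types W : vectType K.

Definition ext_in V (v : V) : ext iota V := \row_i iota (bcoord i v).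

Definition iota_linear V W (f : V -> W) : Prop :=
  forall a u v, f (a *: u + v) = iota a *: f u + f v.

Lemma ext_in_linear V : iota_linear (@ext_in V).
Proof.
by move=> a u v; apply/rowP=> i; rewrite !mxE bcoord_linear rmorphD rmorphM.
Qed.

Definition ext_lift_fun V W (f : V -> W) (x : ext iota V) : W :=
  \sum_i x 0 i *: f (bvec i).

Lemma ext_lift_linear V W (f : V -> W) : linear (ext_lift_fun f).
Proof.
move=> a x y; rewrite /ext_lift_fun scaler_sumr -big_split.
by apply: eq_bigr => i _; rewrite !mxE scalerDl scalerA.
Qed.

Definition ext_lift V W (f : V -> W) : 'Hom(ext iota V, W) :=
  mklin (ext_lift_linear f).

Lemma iota_linear0 V W (f : V -> W) : iota_linear f -> f 0 = 0.
Proof.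
by move=> fL; have := fL (-1) 0 0; rewrite scaler0 addr0 rmorphN1 scaleN1r addNr.
Qed.

Lemma iota_linear_sum V W (f : V -> W) : iota_linear f ->
  forall (I : finType) (c : I -> k) (v : I -> V),
    f (\sum_i c i *: v i) = \sum_i iota (c i) *: f (v i).
Proof.
move=> fL I c v; elim/big_rec2: _ => [|i y x _ <-]; first exact: iota_linear0.
by rewrite fL.
Qed.

Lemma ext_liftE V W (f : V -> W) : iota_linear f ->
  forall v, ext_lift f (ext_in v) = f v.
Proof.
move=> fL v; rewrite mklinE [v in RHS]bcoord_sum iota_linear_sum //.
by apply: eq_bigr => i _; rewrite mxE.
Qed.

Lemma ext_in_bvec V i : ext_in (bvec i : V) = delta_mx 0 i.
Proof. by apply/rowP=> j; rewrite !mxE bcoord_bvec rmorph_nat eq_sym. Qed.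

Lemma ext_sum V (x : ext iota V) : x = \sum_i x 0 i *: ext_in (bvec i).
Proof.
rewrite [x in LHS]row_sum_delta; apply: eq_bigr => i _.
by rewrite ext_in_bvec.
Qed.

Lemma ext_fun_ext V W (f g : ext iota V -> W) : linear f -> linear g ->
  (forall v, f (ext_in v) = g (ext_in v)) -> f =1 g.
Proof.
move=> fL gL fg x; rewrite [x]ext_sum (linfun_sum fL) (linfun_sum gL).
by apply: eq_bigr => i _; rewrite (linfunZ fL) (linfunZ gL) fg.
Qed.

Lemma ext_lift_lin V W (f g h : V -> W) a :
  (forall u, h u = a *: f u + g u) ->
  forall x, ext_lift h x = a *: ext_lift f x + ext_lift g x.
Proof.
move=> E x; rewrite !mklinE /ext_lift_fun scaler_sumr -big_split.
by apply: eq_bigr => i _; rewrite E scalerDr !scalerA mulrC.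
Qed.

Definition ext_map U V (f : 'Hom(U, V)) : 'Hom(ext iota U, ext iota V) :=
  ext_lift (fun u => ext_in (f u)).

Lemma ext_mapE U V (f : 'Hom(U, V)) u : ext_map f (ext_in u) = ext_in (f u).
Proof. by apply: ext_liftE => a x y; rewrite linearP ext_in_linear. Qed.

End ScalarExtension.

(* K (x)_k A with (c (x) a) (c' (x) a') = cc' (x) aa'. *)
Definition ext_alg (k K : fieldType) (iota : {rmorphism k -> K})
  (A : falgType k) : Type := ext iota A.
HB.instance Definition _ (k K : fieldType) (iota : {rmorphism k -> K})
  (A : falgType k) := Vector.on (ext_alg iota A).

Section AlgebraExtension.
Context {k K : fieldType} (iota : {rmorphism k -> K}) (A : falgType k).
Local Notation AK := (ext_alg iota A).
Local Notation inA := (@ext_in k K iota A : A -> AK).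

Definition ext_mul (x y : AK) : AK :=
  ext_lift iota (fun a => ext_lift iota (fun b => inA (a * b)) y) x.

Definition ext_one : AK := inA 1.

Lemma ext_mulDZl c (x y z : AK) :
  ext_mul (c *: x + y) z = c *: ext_mul x z + ext_mul y z.
Proof. by rewrite /ext_mul linearP. Qed.

Lemma ext_mulDZr c (x y z : AK) :
  ext_mul z (c *: x + y) = c *: ext_mul z x + ext_mul z y.
Proof. by rewrite /ext_mul; apply: ext_lift_lin => a; rewrite linearP. Qed.

Lemma ext_mul_in (a b : A) : ext_mul (inA a) (inA b) = inA (a * b).
Proof.
have L x : iota_linear iota (fun b => inA (x * b)).
  by move=> c u v; rewrite mulrDr -scalerAr ext_in_linear.
rewrite /ext_mul ext_liftE ?ext_liftE // => c u v.
by apply: ext_lift_lin => w; rewrite mulrDl -scalerAl ext_in_linear.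
Qed.

Lemma ext_mulA : associative ext_mul.
Proof.
move=> x y z; move: x.
apply: ext_fun_ext => [c u v|c u v|a]; rewrite ?ext_mulDZl //.
move: y; apply: ext_fun_ext => [c u v|c u v|b].
- by rewrite ext_mulDZl ext_mulDZr.
- by rewrite ext_mulDZr ext_mulDZl.
move: z; apply: ext_fun_ext => [c u v|c u v|d].
- by rewrite !ext_mulDZr.
- by rewrite !ext_mulDZr.
by rewrite !ext_mul_in mulrA.
Qed.

Lemma ext_mul1l : left_id ext_one ext_mul.
Proof.
apply: ext_fun_ext => [c u v|//|a]; first by rewrite ext_mulDZr.
by rewrite ext_mul_in mul1r.
Qed.

Lemma ext_mul1r : right_id ext_one ext_mul.
Proof.
apply: ext_fun_ext => [c u v|//|a]; first by rewrite ext_mulDZl.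
by rewrite ext_mul_in mulr1.
Qed.

Lemma ext_mulDl : left_distributive ext_mul +%R.
Proof. by move=> x y z; have := ext_mulDZl 1 x y z; rewrite !scale1r. Qed.

Lemma ext_mulDr : right_distributive ext_mul +%R.
Proof. by move=> z x y; have := ext_mulDZr 1 x y z; rewrite !scale1r. Qed.

Lemma ext_one_neq0 : ext_one != 0.
Proof.
apply/eqP=> E; have /eqP[] := oner_neq0 A; rewrite [RHS]bcoord_sum.
rewrite [LHS]bcoord_sum; apply: eq_bigr => i _.
have /rowP/(_ i) := E; rewrite !mxE => /eqP; rewrite fmorph_eq0 => /eqP->.
by rewrite /bcoord linear0.
Qed.

HB.instance Definition _ := GRing.Zmodule_isNzRing.Build AK
  ext_mulA ext_mul1l ext_mul1r ext_mulDl ext_mulDr ext_one_neq0.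

Lemma ext_scaleAl (c : K) (x y : AK) : c *: (x * y) = (c *: x) * y.
Proof. by have := ext_mulDZl c x 0 y; rewrite addr0 (mul0r y : ext_mul 0 y = 0) addr0. Qed.
HB.instance Definition _ := GRing.Lmodule_isLalgebra.Build K AK ext_scaleAl.

Lemma ext_scaleAr (c : K) (x y : AK) : c *: (x * y) = x * (c *: y).
Proof. by have := ext_mulDZr c y 0 x; rewrite addr0 (mulr0 x : ext_mul x 0 = 0) addr0. Qed.
HB.instance Definition _ := GRing.Lalgebra_isAlgebra.Build K AK ext_scaleAr.
HB.instance Definition _ := Algebra_isFalgebra.Build K AK.

Lemma ext_algM (a b : A) : inA (a * b) = inA a * inA b.
Proof. by rewrite -ext_mul_in. Qed.

Section ModuleExtension.
Context (V : fdmod A).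

(* (c (x) a) (d (x) v) = cd (x) av *)
Definition ext_act : 'Hom(AK, 'End(ext iota V)) :=
  ext_lift iota (fun a => ext_map iota (act V a)).

Lemma ext_actE (a : A) (v : V) :
  ext_act (inA a) (ext_in iota v) = ext_in iota (act V a v).
Proof.
rewrite /ext_act ext_liftE ?ext_mapE // => c x y.
apply/lfunP; apply: ext_fun_ext => [d u w|d u w|u]; try by rewrite linearP.
by rewrite add_lfunE scale_lfunE !ext_mapE linearP add_lfunE scale_lfunE ext_in_linear.
Qed.

Lemma ext_act1 : ext_act 1 = \1%VF.
Proof.
apply/lfunP; apply: ext_fun_ext => [d u w|d u w|u]; try by rewrite linearP.
by rewrite ext_actE act1 !id_lfunE.
Qed.

Lemma ext_actM (x y : AK) : ext_act (x * y) = (ext_act x \o ext_act y)%VF.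
Proof.
apply/lfunP => w; rewrite comp_lfunE; move: x.
apply: ext_fun_ext => [d u v|d u v|a].
- by rewrite mulrDl -scalerAl linearP add_lfunE scale_lfunE.
- by rewrite linearP add_lfunE scale_lfunE.
move: y; apply: ext_fun_ext => [d u v|d u v|b].
- by rewrite mulrDr -scalerAr linearP add_lfunE scale_lfunE.
- by rewrite linearP add_lfunE scale_lfunE linearP.
move: w; apply: ext_fun_ext => [d u v|d u v|v]; try by rewrite !linearP.
by rewrite -ext_algM !ext_actE actM comp_lfunE.
Qed.

Definition ext_mod : fdmod AK := FdMod ext_act1 ext_actM.

End ModuleExtension.
End AlgebraExtension.

Definition absolutely_simple (k : fieldType) (A : falgType k) (V : fdmod A)
  : Prop :=
  simple_mod V /\
  forall (K : fieldType) (iota : {rmorphism k -> K}),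
    simple_mod (ext_mod iota V).

(* The quotient vector space V / U, realized on a complement of U: quo_pi is
   the projection V -> V / U and quo_map f is the endomorphism v + U |-> f v + U
   when f maps U into itself (see quo_piP, quo_pi_surj and quo_mapE). *)
Section Quotient.
Context {k : fieldType} {V : vectType k} (U : {vspace V}).

Definition quo : vectType k := subvs_of U^C.

Definition quo_pi : 'Hom(V, quo) := (linfun (vsproj U^C) \o daddv_pi U^C U)%VF.

Definition quo_map (f : 'End(V)) : 'End(quo) :=
  (quo_pi \o f \o linfun vsval)%VF.

Let capCU : (U^C :&: U = 0)%VS. Proof. by rewrite capvC capv_compl. Qed.

Lemma vsval_quo_pi v : vsval (quo_pi v) = daddv_pi U^C U v.
Proof. by rewrite comp_lfunE lfunE /= vsprojK // memv_pi. Qed.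

Lemma quo_piP v : (quo_pi v == 0) = (v \in U).
Proof.
rewrite -val_eqE /= vsval_quo_pi.
have E : daddv_pi U^C U v + daddv_pi U U^C v = v.
  by apply: daddv_pi_add; rewrite // addvC addv_complf memvf.
apply/eqP/idP => [v0|vU]; first by rewrite -E v0 add0r memv_pi.
by move: E; rewrite (daddv_pi_id (capv_compl U) vU) => /(canRL (addrK _)); rewrite subrr.
Qed.

Lemma quo_pi_surj (q : quo) : quo_pi (vsval q) = q.
Proof.
by apply/val_inj; rewrite /= vsval_quo_pi daddv_pi_id // subvsP.
Qed.

Lemma quo_mapE f : (f @: U <= U)%VS ->
  forall v, quo_map f (quo_pi v) = quo_pi (f v).
Proof.
move=> fU v.
have -> : quo_map f (quo_pi v) = quo_pi (f (vsval (quo_pi v))).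
  by rewrite (comp_lfunE (quo_pi \o f)%VF) (comp_lfunE quo_pi) (lfunE vsval).
apply/eqP; rewrite -subr_eq0 -!linearB quo_piP.
apply: (subvP fU); apply: memv_img.
by rewrite -quo_piP linearB /= quo_pi_surj subrr.
Qed.

End Quotient.

Section HopfModules.
Context {k : fieldType} {H : hopfAlg k}.
Implicit Types V W X : fdmod H.

Definition tact V W : 'Hom(tens H H, 'End(tens V W)) :=
  tlift (fun a b => tmap (act V a) (act W b)).

Lemma tactE V W a b v w :
  tact V W (a ⊗ b) (v ⊗ w) = act V a v ⊗ act W b w.
Proof.
rewrite tliftE ?tmapE //; split=> x c y z; apply: tens_ext => p q.
  by rewrite add_lfunE scale_lfunE !tmapE linearP add_lfunE scale_lfunE pureDZr.
by rewrite add_lfunE scale_lfunE !tmapE linearP add_lfunE scale_lfunE pureDZl.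
Qed.

Lemma tact_tlift V W t v w :
  tact V W t (v ⊗ w) = tlift (fun a b => act V a v ⊗ act W b w) t.
Proof.
move: t; apply: tens_fun_ext => [c x y|c x y|a b].
- by rewrite linearP add_lfunE scale_lfunE.
- by rewrite linearP.
rewrite tactE tliftE //; split=> x c y z.
  by rewrite linearP add_lfunE scale_lfunE pureDZr.
by rewrite linearP add_lfunE scale_lfunE pureDZl.
Qed.

Definition tens_act V W : 'Hom(H, 'End(tens V W)) := (tact V W \o comul H)%VF.

Lemma tens_act1 V W : tens_act V W 1 = \1%VF.
Proof.
apply: tens_ext => v w.
by rewrite comp_lfunE comul1 tactE !act1 !id_lfunE.
Qed.

Lemma tmulDZl (A B : falgType k) c (x y t : tens A B) :
  tmul (c *: x + y) t = c *: tmul x t + tmul y t.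
Proof. by rewrite /tmul linearP. Qed.

Lemma tmulDZr (A B : falgType k) c (x y s : tens A B) :
  tmul s (c *: x + y) = c *: tmul s x + tmul s y.
Proof. by rewrite /tmul; apply: tlift_lin => a b; rewrite linearP. Qed.

Lemma tactM V W s t : tact V W (tmul s t) = (tact V W s \o tact V W t)%VF.
Proof.
apply: tens_ext => v w; rewrite comp_lfunE; move: s.
apply: tens_fun_ext => [c x y|c x y|a b].
- by rewrite tmulDZl linearP add_lfunE scale_lfunE.
- by rewrite linearP add_lfunE scale_lfunE.
move: t; apply: tens_fun_ext => [c x y|c x y|a' b'].
- by rewrite tmulDZr linearP add_lfunE scale_lfunE.
- by rewrite linearP add_lfunE scale_lfunE linearP.
by rewrite tmulE !tactE !actM !comp_lfunE.
Qed.

Lemma tens_actM V W a b :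
  tens_act V W (a * b) = (tens_act V W a \o tens_act V W b)%VF.
Proof. by rewrite !(comp_lfunE (tact V W)) comulM tactM. Qed.

Definition tens_mod V W : fdmod H :=
  @FdMod k H (tens V W) (tens_act V W) (tens_act1 V W) (@tens_actM V W).

Lemma tens_modE V W a v w :
  act (tens_mod V W) a (v ⊗ w) =
  tlift (fun a1 a2 => act V a1 v ⊗ act W a2 w) (comul H a).
Proof. by rewrite /= comp_lfunE tact_tlift. Qed.

Lemma unit_act_linear : linear (fun a : H => (counit H a : k) *: (\1%VF : 'End(k^o))).
Proof. by move=> c a b; rewrite linearP scalerDl scalerA. Qed.

Lemma unit_actE a : mklin unit_act_linear a = (counit H a : k) *: \1%VF.
Proof. exact: mklinE. Qed.

Lemma unit_act1 : mklin unit_act_linear 1 = \1%VF.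
Proof. by rewrite unit_actE counit1 scale1r. Qed.

Lemma unit_actM a b : mklin unit_act_linear (a * b) =
  (mklin unit_act_linear a \o mklin unit_act_linear b)%VF.
Proof.
apply/lfunP=> x; rewrite comp_lfunE !unit_actE !scale_lfunE !id_lfunE.
by rewrite counitM scalerA.
Qed.

Definition unit_mod : fdmod H := FdMod unit_act1 unit_actM.

Lemma dual_end_linear V (g : 'End(V)) :
  linear (fun f : 'Hom(V, k^o) => (f \o g)%VF).
Proof. by move=> c f1 f2; rewrite comp_lfunDl comp_lfunZl. Qed.

Definition dual_end V (g : 'End(V)) : 'End('Hom(V, k^o)) :=
  mklin (dual_end_linear g).

Lemma dual_endE V (g : 'End(V)) (f : 'Hom(V, k^o)) : dual_end g f = (f \o g)%VF.
Proof. exact: mklinE. Qed.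

(* The action on the left dual is (h f)(v) = f (S(h) v). *)
Lemma dual_act_linear V : linear (fun h : H => dual_end (act V (antipode H h))).
Proof.
move=> c a b; apply/lfunP=> f; apply/lfunP=> v.
rewrite !(add_lfunE, scale_lfunE) !dual_endE.
by rewrite !(comp_lfunE, add_lfunE, scale_lfunE) !linearP /= !(add_lfunE, scale_lfunE) linearP.
Qed.

Definition dual_act V : 'Hom(H, 'End('Hom(V, k^o))) := mklin (dual_act_linear V).

Lemma dual_actE V h (f : 'Hom(V, k^o)) v :
  dual_act V h f v = f (act V (antipode H h) v).
Proof. by rewrite mklinE dual_endE comp_lfunE. Qed.

Lemma dual_act1 V : dual_act V 1 = \1%VF.
Proof.
apply/lfunP=> f; apply/lfunP=> v.
by rewrite dual_actE antipode1 act1 !id_lfunE.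
Qed.

Lemma dual_actM V a b : dual_act V (a * b) = (dual_act V a \o dual_act V b)%VF.
Proof.
apply/lfunP=> f; apply/lfunP=> v.
by rewrite comp_lfunE !dual_actE antipodeM actM comp_lfunE.
Qed.

Definition dual_mod V : fdmod H := FdMod (dual_act1 V) (@dual_actM V).

Definition self_dual V : Prop := isomorphic V (dual_mod V).

Lemma antipode_ann V : self_dual V -> (antipode H @: ann V <= ann V)%VS.
Proof.
case=> f [g [gf fg]]; apply/subvP=> _ /memv_imgP[h hV ->].
move: hV; rewrite !memv_ker => /eqP hV; apply/eqP/lfunP=> v; rewrite zero_lfunE.
have z (x : 'Hom(V, k^o)) : x (act V (antipode H h) v) = 0.
  have E : dual_act V h (f (g x)) = 0.
    by rewrite -[LHS](modhomE f h (g x)) hV zero_lfunE linear0.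
  have fgx : f (g x) = x.
    by have /(congr1 (fun u : modhom (dual_mod V) (dual_mod V) => u x)) := fg; rewrite /= comp_lfunE id_lfunE.
  by rewrite -dual_actE -{1}fgx E zero_lfunE.
rewrite [LHS]bcoord_sum big1 // => i _.
have := z (@mklin k V k^o (bcoord i) (bcoord_linear i)).
by rewrite mklinE => ->; rewrite scale0r.
Qed.

(* Tr(S_V) on H / ann V if V is self-dual (see antipode_ann and quo_mapE). *)
Definition gamma V : k :=
  if `[< self_dual V >] then lfun_trace (quo_map (ann V) (antipode H)) else 0.

Lemma tens_hom_subproof V V' W W' (f : modhom V V') (g : modhom W W') a :
  (tmap f g \o act (tens_mod V W) a = act (tens_mod V' W') a \o tmap f g)%VF.
Proof.
apply: tens_ext => v w; rewrite [LHS]comp_lfunE [RHS]comp_lfunE.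
rewrite tmapE !tens_modE tlift_comp; last by move=> c x y; rewrite linearP.
by congr (fun_of_lfun _ _); apply: tlift_eq => x y; rewrite tmapE !modhomE.
Qed.

Definition tens_hom V V' W W' (f : modhom V V') (g : modhom W W') :
    modhom (tens_mod V W) (tens_mod V' W') :=
  @ModHom k H (tens_mod V W) (tens_mod V' W') _ (tens_hom_subproof f g).

Lemma assoc_subproof V W X a :
  (tassoc V W X \o act (tens_mod (tens_mod V W) X) a =
   act (tens_mod V (tens_mod W X)) a \o tassoc V W X)%VF.
Proof.
apply: tens_ext => t x; rewrite [LHS]comp_lfunE [RHS]comp_lfunE.
move: t; apply: tens_fun_ext => [c p q|c p q|v w].
- by rewrite pureDZl !linearP.
- by rewrite pureDZl !linearP.
rewrite tassocE !tens_modE.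
rewrite (tlift_comp _ (L := tassoc V W X)); last by move=> c p q; rewrite linearP.
pose g a1 a2 a3 := act V a1 v ⊗ (act W a2 w ⊗ act X a3 x).
transitivity (tlift (fun a12 a3 => tlift (fun a1 a2 => g a1 a2 a3)
    (comul H a12)) (comul H a)).
  congr (fun_of_lfun _ _); apply: tlift_eq => a12 a3; rewrite tens_modE.
  rewrite (tlift_comp _ (L := fun t => tassoc V W X (t ⊗ act X a3 x))).
    by congr (fun_of_lfun _ _); apply: tlift_eq => a1 a2; rewrite tassocE.
  by move=> c p q; rewrite pureDZl linearP.
rewrite comulA3 => [|y z|y z|y z] ; first last.
- by move=> c p q; rewrite /g linearP add_lfunE scale_lfunE !pureDZr.
- by move=> c p q; rewrite /g linearP add_lfunE scale_lfunE pureDZl pureDZr.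
- by move=> c p q; rewrite /g linearP add_lfunE scale_lfunE pureDZl.
congr (fun_of_lfun _ _); apply: tlift_eq => a1 a23; rewrite tens_modE.
rewrite (tlift_comp _ (L := fun t => act V a1 v ⊗ t)) //.
by move=> c p q; rewrite pureDZr.
Qed.

Definition hom_assoc V W X :
    modhom (tens_mod (tens_mod V W) X) (tens_mod V (tens_mod W X)) :=
  @ModHom k H (tens_mod (tens_mod V W) X) (tens_mod V (tens_mod W X)) _
    (assoc_subproof V W X).

Lemma lunit_subproof V a :
  (tlunit V \o act (tens_mod unit_mod V) a = act V a \o tlunit V)%VF.
Proof.
apply: tens_ext => c v; rewrite [LHS]comp_lfunE [RHS]comp_lfunE.
rewrite tens_modE tlunitE linearZ /= tlift_comp; last by move=> d x y; rewrite linearP.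
rewrite -(counitlE (f := fun b => (c : k) *: act V b v)); last first.
  by move=> d x y; rewrite linearP add_lfunE scale_lfunE scalerDr !scalerA mulrC.
congr (fun_of_lfun _ _); apply: tlift_eq => x y.
by rewrite tlunitE unit_actE scale_lfunE id_lfunE scalerA.
Qed.

Definition hom_lunit V : modhom (tens_mod unit_mod V) V :=
  @ModHom k H (tens_mod unit_mod V) V _ (lunit_subproof V).

Lemma runit_subproof V a :
  (trunit V \o act (tens_mod V unit_mod) a = act V a \o trunit V)%VF.
Proof.
apply: tens_ext => v c; rewrite [LHS]comp_lfunE [RHS]comp_lfunE.
rewrite tens_modE trunitE linearZ /= tlift_comp; last by move=> d x y; rewrite linearP.
rewrite -(counitrE (f := fun b => (c : k) *: act V b v)); last first.
  by move=> d x y; rewrite linearP add_lfunE scale_lfunE scalerDr !scalerA mulrC.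
congr (fun_of_lfun _ _); apply: tlift_eq => x y.
by rewrite trunitE unit_actE scale_lfunE id_lfunE scalerA.
Qed.

Definition hom_runit V : modhom (tens_mod V unit_mod) V :=
  @ModHom k H (tens_mod V unit_mod) V _ (runit_subproof V).

End HopfModules.
Arguments unit_mod {k} H.

Record functor (k : fieldType) (A B : falgType k) := Functor {
  fobj :> fdmod A -> fdmod B;
  fmap : forall V W, modhom V W -> modhom (fobj V) (fobj W);
  fmap_id : forall V, fmap (hom_id V) = hom_id (fobj V);
  fmap_comp : forall V W X (g : modhom W X) (f : modhom V W),
    fmap (hom_comp g f) = hom_comp (fmap g) (fmap f);
}.
Arguments fmap {k A B} _ {V W} _.

Section Functors.
Context {k : fieldType}.

Definition klinear (A B : falgType k) (F : functor A B) : Prop :=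
  forall V W (c : k) (f g : modhom V W),
    fmap F (hom_lincomb c f g) = hom_lincomb c (fmap F f) (fmap F g).

Definition functor_id (A : falgType k) : functor A A :=
  @Functor k A A id (fun V W => id) (fun V => erefl)
    (fun V W X g f => erefl).

Lemma functor_comp_id (A B C : falgType k) (G : functor B C) (F : functor A B) V :
  fmap G (fmap F (hom_id V)) = hom_id (G (F V)).
Proof. by rewrite !fmap_id. Qed.

Lemma functor_comp_comp (A B C : falgType k) (G : functor B C) (F : functor A B)
    V W X (g : modhom W X) (f : modhom V W) :
  fmap G (fmap F (hom_comp g f)) =
  hom_comp (fmap G (fmap F g)) (fmap G (fmap F f)).
Proof. by rewrite !fmap_comp. Qed.

Definition functor_comp (A B C : falgType k) (G : functor B C) (F : functor A B) :
    functor A C :=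
  Functor (functor_comp_id G F) (functor_comp_comp G F).

Definition nat_isomorphic (A B : falgType k) (F G : functor A B) : Prop :=
  exists eta : forall V, modhom (F V) (G V),
    (forall V W (f : modhom V W),
      hom_comp (eta W) (fmap F f) = hom_comp (fmap G f) (eta V)) /\
    (forall V, is_iso (eta V)).

Definition is_equivalence (A B : falgType k) (F : functor A B) : Prop :=
  exists G : functor B A,
    nat_isomorphic (functor_comp G F) (functor_id A) /\
    nat_isomorphic (functor_comp F G) (functor_id B).

End Functors.

(* A k-linear tensor (strong monoidal) functor (F, J, phi) whose underlying
   functor is an equivalence of categories. *)
Record tensor_equivalence (k : fieldType) (H H' : hopfAlg k) :=
    TensorEquivalence {
  teq_functor :> functor H H';
  teq_klinear : klinear teq_functor;
  teq_equivalence : is_equivalence teq_functor;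
  teq_J : forall V W : fdmod H,
    modhom (tens_mod (teq_functor V) (teq_functor W))
           (teq_functor (tens_mod V W));
  teq_J_iso : forall V W, is_iso (teq_J V W);
  teq_J_natural : forall (V V' W W' : fdmod H)
      (f : modhom V V') (g : modhom W W'),
    hom_comp (teq_J V' W') (tens_hom (fmap teq_functor f) (fmap teq_functor g))
    = hom_comp (fmap teq_functor (tens_hom f g)) (teq_J V W);
  teq_phi : modhom (unit_mod H') (teq_functor (unit_mod H));
  teq_phi_iso : is_iso teq_phi;
  teq_assoc : forall V W X : fdmod H,
    hom_comp (fmap teq_functor (hom_assoc V W X))
      (hom_comp (teq_J (tens_mod V W) X)
        (tens_hom (teq_J V W) (hom_id (teq_functor X))))
    = hom_comp (teq_J V (tens_mod W X))
        (hom_comp (tens_hom (hom_id (teq_functor V)) (teq_J W X))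
          (hom_assoc (teq_functor V) (teq_functor W) (teq_functor X)));
  teq_lunit : forall V : fdmod H,
    hom_comp (fmap teq_functor (hom_lunit V))
      (hom_comp (teq_J (unit_mod H) V)
        (tens_hom teq_phi (hom_id (teq_functor V))))
    = hom_lunit (teq_functor V);
  teq_runit : forall V : fdmod H,
    hom_comp (fmap teq_functor (hom_runit V))
      (hom_comp (teq_J V (unit_mod H))
        (tens_hom (hom_id (teq_functor V)) teq_phi))
    = hom_runit (teq_functor V)
}.

(* Main.v *)
(* A module V is self-dual iff there are module maps b : V (x) V -> 1 and
   c : 1 -> V (x) V satisfying a zigzag identity. If moreover H -> End(V) is
   surjective, then S_V is the adjunction with respect to b on End(V), and its
   trace is the scalar b o c. Strong monoidal functors transport such pairs and
   preserve this scalar, and an equivalence also reflects them, being full and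
   faithful. An absolutely simple V has only scalar endomorphisms; simplicity and
   scalar endomorphisms pass to F V, so surjectivity holds for both V and F V by
   the density theorem. *)

Require Import Defs.
From mathcomp Require Import all_boot all_order all_algebra all_field.
From mathcomp Require Import boolp.

Set Implicit Arguments.
Unset Strict Implicit.
Unset Printing Implicit Defensive.

Import GRing.Theory.
Local Open Scope ring_scope.

(** * Endomorphisms and density for simple modules *)

Lemma irreducible_divisor (F : fieldType) (p : {poly F}) :
  (1 < size p)%N -> exists2 q, irreducible_poly q & q %| p.
Proof.
have [n] := ubnP (size p); elim: n p => // n IHn p; rewrite ltnS => ple p1.
have [irr|] := EM (irreducible_poly p); first by exists p.
move=> nirr; have [q [q1 qp qNp]] : exists q : {poly F}, [/\ size q != 1%N, q %| p & ~~ (q %= p)].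
  apply: contrapT => H; apply: nirr; split=> // q q1 qp.
  by apply: contrapT => /negP qNp; apply: H; exists q.
have p0 : p != 0 by rewrite -size_poly_gt0 (ltn_trans _ p1).
have q0 : q != 0 by apply: contraTneq qp => ->; rewrite dvd0p.
have lt : (size q < size p)%N.
  by rewrite ltn_neqAle dvdp_leq // andbT dvdp_size_eqp.
have [||r irr rq] := IHn q; first exact: leq_trans lt ple.
  by rewrite ltn_neqAle eq_sym q1 size_poly_gt0.
by exists r => //; apply: dvdp_trans rq qp.
Qed.

(** Adjoin a root of one irreducible factor. For a characteristic polynomial this supplies an
    eigenvalue over an extension. *)
Lemma root_in_extension (F : fieldType) (p : {poly F}) : (1 < size p)%N ->
  exists (K : fieldType) (iota : {rmorphism F -> K}) (z : K),
    root (map_poly iota p) z.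
Proof.
move=> /irreducible_divisor[q /irredp_FAdjoin[L _ [z qz _]] /dvdpP[r ->]].
by exists L, (in_alg L), z; rewrite rmorphM rootM qz orbT.
Qed.

Lemma simple_neq0 (k : fieldType) (A : falgType k) (V : fdmod A) :
  simple_mod V -> exists v : V, v != 0.
Proof.
by case=> /eqP nz _; exists (vpick {:V}); rewrite vpick0.
Qed.

Lemma lfun_combE (k : fieldType) (V W : vectType k) (c : k) (f g : 'Hom(V, W)) v :
  (c *: f + g) v = c *: f v + g v.
Proof. by rewrite add_lfunE scale_lfunE. Qed.

Lemma lfun_bvecP (k : fieldType) (V W : vectType k) (f g : 'Hom(V, W)) :
  (forall i, f (bvec i) = g (bvec i)) -> f = g.
Proof.
move=> fg; apply/lfunP => v; rewrite [v]bcoord_sum !linear_sum.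
by apply: eq_bigr => i _; rewrite !linearZ /= fg.
Qed.

(** Schur's condition that End(V) = k. It speaks only of morphisms, so it passes through a k-linear
    equivalence. *)
Definition endo_scalar (k : fieldType) (A : falgType k) (V : fdmod A) : Prop :=
  forall f : modhom V V, exists c : k, forall v, f v = c *: v.

(* An eigenvector over an extension of k spans, by simplicity there, everything:
   the endomorphism becomes scalar over K, hence is scalar over k. *)
Lemma absolutely_simple_endo (k : fieldType) (A : falgType k) (V : fdmod A) :
  absolutely_simple V -> endo_scalar V.
Proof.
case=> sV absV f; pose M : 'M[k]_(\dim {:V}) := \matrix_(i, j) bcoord j (f (bvec i)).
have [v v0] := simple_neq0 sV.
have n0 : (0 < \dim {:V})%N.
  by rewrite lt0n dimv_eq0; apply/eqP; case: sV.
have [|K [iota [z rz]]] := @root_in_extension _ (char_poly M); first by rewrite size_char_poly ltnS.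
move: rz; rewrite map_char_poly -eigenvalue_root_char => /eigenvalueP[x xM x0].
(* The rows of [M] are the images of the basis vectors, so [M] acts on row vectors from the right,
   matching the convention of [eigenvalue]. *)
have ME (y : ext iota V) : ext_map iota f y = y *m map_mx iota M.
  rewrite mklinE /ext_lift_fun; apply/rowP => j; rewrite summxE mxE.
  by apply: eq_bigr => i _; rewrite !mxE.
pose U : {vspace ext_mod iota V} := lker (ext_map iota f - z *: \1)%VF.
have UE y : (y \in U) = (ext_map iota f y == z *: y).
  by rewrite memv_ker add_lfunE opp_lfunE scale_lfunE id_lfunE subr_eq0.
have fA (a : ext_alg iota A) y : ext_map iota f (ext_act iota V a y) = ext_act iota V a (ext_map iota f y).
  move: a; apply: ext_fun_ext => [c s t|c s t|a].
  - by rewrite linearP lfun_combE linearP.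
  - by rewrite linearP lfun_combE.
  move: y; apply: ext_fun_ext => [c s t|c s t|y]; try by rewrite !linearP.
  by rewrite ext_actE !ext_mapE ext_actE modhomE.
have subU : submodule U.
  move=> a; apply/subvP => _ /memv_imgP[y yU ->].
  by move: yU; rewrite !UE /= fA => /eqP->; rewrite linearZ.
have [_ /(_ U subU)[U0|UT]] := absV K iota.
  have : x \in U by rewrite UE ME xM.
  by rewrite U0 memv0 (negPf x0).
(* As the eigenspace [U] is everything, [M] becomes z times the identity over K. All diagonal
   entries have image z, so injectivity of [iota] makes them one scalar of k. *)
have zE i : iota (M i i) = z /\ forall j, j != i -> M i j = 0.
  have : (delta_mx 0 i : ext iota V) \in U by rewrite UT memvf.
  rewrite UE ME -rowE => /eqP/rowP E; split=> [|j ji].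
    by have := E i; rewrite !mxE !eqxx mulr1.
  by have /eqP := E j; rewrite !mxE (negPf ji) mulr0 fmorph_eq0 => /eqP.
pose i0 := Ordinal n0; exists (M i0 i0) => w.
have -> : M i0 i0 *: w = (M i0 i0 *: \1)%VF w by rewrite scale_lfunE id_lfunE.
move: w; apply/lfunP/lfun_bvecP => i; rewrite scale_lfunE id_lfunE.
rewrite [LHS]bcoord_sum (bigD1 i) //= big1 => [|j ji].
  rewrite addr0; congr (_ *: _).
  by apply: (fmorph_inj iota); rewrite (zE i0).1 -(zE i).1 mxE.
by have := (zE i).2 j ji; rewrite mxE => ->; rewrite scale0r.
Qed.

(** * The density theorem for a simple module with scalar endomorphisms *)

Section Density.
Context {k : fieldType} {A : falgType k} (V : fdmod A).
Hypotheses (sV : simple_mod V) (eV : endo_scalar V).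

Lemma act_scal a (c : k) b (v : V) :
  act V (c *: a + b) v = c *: act V a v + act V b v.
Proof. by rewrite linearP lfun_combE. Qed.

(** The cyclic submodule generated by [act V a x] is nonzero, hence all of V. Its elements are the
    [act V (b * a) x], and [b * a] stays in the left ideal [I]. *)
Lemma left_ideal_full (I : A -> Prop) (x : V) :
  (forall c a b, I a -> I b -> I (c *: a + b)) -> (forall a b, I b -> I (a * b)) ->
  (exists2 a, I a & act V a x != 0) ->
  forall w, exists2 a, I a & act V a x = w.
Proof.
move=> IL IM [a Ia ax0] w.
have evL : linear (fun b : A => act V b (act V a x)) by move=> c b d; rewrite act_scal.
have subU : submodule (limg (mklin evL)).
  move=> b; apply/subvP => _ /memv_imgP[_ /memv_imgP[d _ ->] ->].
  have -> : act V b (mklin evL d) = mklin evL (b * d).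
    by rewrite !mklinE actM comp_lfunE.
  exact: memv_img (memvf _).
have [_ /(_ _ subU)[U0|UT]] := sV.
  have : mklin evL 1 \in limg (mklin evL) by exact: memv_img (memvf _).
  by rewrite U0 memv0 mklinE act1 id_lfunE (negPf ax0).
have : w \in limg (mklin evL) by rewrite UT memvf.
move=> /memv_imgP[b _ ->]; exists (b * a); first exact: IM.
by rewrite mklinE actM comp_lfunE.
Qed.

(** Double annihilator property, by induction on [s]. Let I annihilate the tail. If I kills the head
    x, the tail suffices. Otherwise I x = V, and a x |-> a v for a in I is a well-defined module
    endomorphism, hence a scalar c; then I kills v - c x, which lies in the span of the tail. *)
Lemma span_closed (s : seq V) v :
  (forall a, (forall u, u \in s -> act V a u = 0) -> act V a v = 0) ->
  v \in <<s>>%VS.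
Proof.
elim: s v => [|x s IHs] v Hv.
  have := Hv 1; rewrite act1 id_lfunE => -> //; exact: mem0v.
pose I a := forall u, u \in s -> act V a u = 0.
have IL c a b : I a -> I b -> I (c *: a + b).
  by move=> Ia Ib u us; rewrite act_scal Ia // Ib // scaler0 addr0.
have IM a b : I b -> I (a * b).
  by move=> Ib u us; rewrite actM comp_lfunE Ib // linear0.
have [[a Ia ax]|nI] := EM (exists2 a, I a & act V a x != 0); last first.
  rewrite span_cons; apply: subvP (addvSr _ _) _ _; apply: IHs => a Ia; apply: Hv => u.
  rewrite inE => /orP[/eqP->|]; last exact: Ia.
  by apply/eqP/negPn/negP => ax; apply: nI; exists a.
have full := left_ideal_full IL IM (ex_intro2 _ _ a Ia ax).
have wd b b' : I b -> I b' -> act V b x = act V b' x -> act V b v = act V b' v.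
  move=> Ib Ib' E; apply/eqP; rewrite eq_sym -subr_eq0 addrC -scaleN1r -act_scal; apply/eqP/Hv => u.
  rewrite inE => /orP[/eqP->|us]; last exact: IL.
  by rewrite act_scal E scaleN1r addNr.
(* A chosen section of a |-> a x on I; by [wd] the vector [act V (s_ u) v] does not depend on the
   choice. *)
pose s_ u := sval (cid2 (full u)).
have Is u : I (s_ u) by rewrite /s_; case: cid2.
have sE u : act V (s_ u) x = u by rewrite /s_; case: cid2.
have thL : linear (fun u => act V (s_ u) v).
  move=> c u w; rewrite -act_scal; apply: wd; rewrite ?act_scal ?sE //.
  exact: IL.
have thH : forall b u, mklin thL (act V b u) = act V b (mklin thL u).
  move=> b u; rewrite !mklinE -comp_lfunE -actM; apply: wd; rewrite ?actM ?comp_lfunE ?sE //.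
  exact: IM.
have [c cE] := eV (ModHom (modhom_subproof thH)).
have vE : v - c *: x \in <<s>>%VS.
  apply: IHs => b Ib; rewrite linearB linearZ /=.
  have := cE (act V b x); rewrite /= mklinE => <-.
  by apply/eqP; rewrite subr_eq0; apply/eqP/wd; rewrite ?sE.
rewrite -(subrK (c *: x) v) addrC span_cons memv_add //.
by rewrite memvZ // memv_line.
Qed.

(** A basis vector lies outside the span of the others, so by [span_closed] some a kills the others
    but not it. By [left_ideal_full] its image can then be prescribed, and g is the action of a sum
    of such elements. *)
Lemma density (g : 'End(V)) : exists a, act V a = g.
Proof.
have dual i : exists2 a, (forall j, j != i -> act V a (bvec j) = 0) & act V a (bvec i) != 0.
  apply: contrapT => H.
  pose s : seq V := [seq bvec j | j <- enum 'I_(\dim {:V}) & j != i].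
  have : bvec i \in <<s>>%VS.
    apply: span_closed => a Ha; apply/eqP/negPn/negP => ai; apply: H; exists a => // j ji.
    by apply: Ha; apply/mapP; exists j; rewrite // mem_filter ji mem_enum.
  have sub : (<<s>> <= lker (@mklin k V k^o (bcoord i) (bcoord_linear i)))%VS.
    apply/span_subvP => _ /mapP[j + ->]; rewrite mem_filter => /andP[ji _].
    by rewrite memv_ker mklinE bcoord_bvec (negPf ji).
  move=> /(subvP sub); rewrite memv_ker mklinE bcoord_bvec eqxx.
  by rewrite (oner_eq0 k).
have elem i w : exists a, forall j, act V a (bvec j) = (j == i)%:R *: w.
  pose I a := forall j, j != i -> act V a (bvec j) = 0.
  have [|||a Ia aE] := @left_ideal_full I (bvec i) _ _ _ w.
  - by move=> c a b Ia Ib j ji; rewrite act_scal Ia // Ib // scaler0 addr0.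
  - by move=> a b Ib j ji; rewrite actM comp_lfunE Ib // linear0.
  - exact: dual.
  exists a => j; case: eqVneq => [->|/Ia->]; rewrite ?scale1r ?scale0r //.
pose h i := sval (cid (elem i (g (bvec i)))).
have hE i j : act V (h i) (bvec j) = (j == i)%:R *: g (bvec i) by rewrite /h; case: cid.
exists (\sum_i h i); apply: lfun_bvecP => j.
rewrite linear_sum sum_lfunE (bigD1 j) //= hE eqxx scale1r big1 ?addr0 // => i ij.
by rewrite hE eq_sym (negPf ij) scale0r.
Qed.

End Density.

(** * Simple modules under equivalences *)

Section SubQuotient.
Context {k : fieldType} {A : falgType k} {V : fdmod A}.
Variables (U : {vspace V}) (subU : submodule U).

Lemma submodule_act a u : u \in U -> act V a u \in U.
Proof. by move=> uU; apply: (subvP (subU a)); apply: memv_img. Qed.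

Definition sub_end (a : A) : 'End(subvs_of U) :=
  (linfun (vsproj U) \o act V a \o linfun vsval)%VF.

Lemma vsval_sub_end a u : vsval (sub_end a u) = act V a (vsval u).
Proof.
by rewrite !comp_lfunE !lfunE /= vsprojK // submodule_act // subvsP.
Qed.

Lemma sub_end_linear : linear sub_end.
Proof.
move=> c a b; apply/lfunP => u; apply: val_inj.
by rewrite /= vsval_sub_end act_scal lfun_combE linearP /= !vsval_sub_end.
Qed.

Lemma sub_act1 : mklin sub_end_linear 1 = \1%VF.
Proof.
apply/lfunP => u; apply: val_inj.
by rewrite /= mklinE vsval_sub_end act1 !id_lfunE.
Qed.

Lemma sub_endM a b u : sub_end (a * b) u = sub_end a (sub_end b u).
Proof. by apply: val_inj; rewrite /= !vsval_sub_end actM comp_lfunE. Qed.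

Lemma sub_actM a b :
  mklin sub_end_linear (a * b) = (mklin sub_end_linear a \o mklin sub_end_linear b)%VF.
Proof. by rewrite !mklinE; apply/lfunP => u; rewrite sub_endM comp_lfunE. Qed.

Definition sub_mod : fdmod A := FdMod sub_act1 sub_actM.

Lemma incl_sub_end a u : linfun vsval (sub_end a u) = act V a (linfun vsval u).
Proof. by rewrite [LHS]lfunE [X in act V a X]lfunE /= vsval_sub_end. Qed.

Lemma sub_incl_subproof a (u : sub_mod) :
  linfun vsval (act sub_mod a u) = act V a (linfun vsval u).
Proof.
rewrite -incl_sub_end.
exact: (congr1 (fun f : 'End(subvs_of U) => linfun vsval (f u)) (mklinE sub_end_linear a)).
Qed.

Definition sub_incl : modhom sub_mod V := ModHom (modhom_subproof sub_incl_subproof).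

Lemma quo_act_linear : linear (fun a : A => quo_map U (act V a)).
Proof.
move=> c a b; apply/lfunP => q.
by rewrite -[q]quo_pi_surj lfun_combE !quo_mapE // act_scal linearP.
Qed.

Lemma quo_act1 : mklin quo_act_linear 1 = \1%VF.
Proof.
rewrite mklinE; apply/lfunP => q.
by rewrite -[q]quo_pi_surj quo_mapE // act1 !id_lfunE.
Qed.

Lemma quo_actM a b :
  mklin quo_act_linear (a * b) = (mklin quo_act_linear a \o mklin quo_act_linear b)%VF.
Proof.
rewrite !mklinE; apply/lfunP => q; rewrite comp_lfunE.
by rewrite -[q]quo_pi_surj !quo_mapE // actM (comp_lfunE (act V a)).
Qed.

Definition quo_mod : fdmod A := FdMod quo_act1 quo_actM.

Lemma quo_proj_subproof a (v : V) : quo_pi U (act V a v) = act quo_mod a (quo_pi U v).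
Proof.
rewrite -(quo_mapE (subU a)).
exact: (congr1 (fun f : 'End(quo U) => f (quo_pi U v)) (esym (mklinE quo_act_linear a))).
Qed.

Definition quo_proj : modhom V quo_mod :=
  ModHom (modhom_subproof (W := quo_mod) quo_proj_subproof).

End SubQuotient.

Lemma lker_submodule (k : fieldType) (A : falgType k) (V W : fdmod A) (f : modhom V W) :
  submodule (lker f).
Proof.
move=> a; apply/subvP => _ /memv_imgP[v vf ->].
by move: vf; rewrite !memv_ker modhomE => /eqP->; rewrite linear0.
Qed.

(* Unlike submodules, this condition is visibly invariant under equivalences. *)
Lemma simple_modP (k : fieldType) (A : falgType k) (V : fdmod A) :
  simple_mod V <->
  hom_lfun (hom_id V) <> 0 /\
  forall (X W : fdmod A) (i : modhom X V) (f : modhom V W),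
    hom_lfun (hom_comp f i) = 0 -> hom_lfun i = 0 \/ hom_lfun f = 0.
Proof.
split=> [sV|[nz fi]].
  split=> [|X W i f fi].
    have [v v0] := simple_neq0 sV => /lfunP/(_ v); rewrite id_lfunE zero_lfunE.
    by move/eqP: v0.
  have [_ /(_ _ (lker_submodule f))[k0|kT]] := sV; [left|right].
    apply/lfunP => x; rewrite zero_lfunE; apply/eqP.
    rewrite -memv0 -k0 memv_ker; have /lfunP/(_ x) := fi.
    by rewrite /= comp_lfunE zero_lfunE => ->.
  apply/lfunP => v; rewrite zero_lfunE; apply/eqP.
  by rewrite -memv_ker kT memvf.
split=> [V0|U subU].
  apply: nz; apply/lfunP => v; rewrite id_lfunE zero_lfunE; apply/eqP.
  by rewrite -memv0 -V0 memvf.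
(* The test pair is the inclusion of U and the projection onto V / U, whose composite vanishes. *)
have [|i0|p0] := fi _ _ (sub_incl subU) (quo_proj subU); [|left|right].
- apply/lfunP => u; rewrite [LHS]comp_lfunE zero_lfunE; apply/eqP.
  by rewrite quo_piP lfunE subvsP.
- apply/vspaceP => u; rewrite memv0; apply/idP/eqP => [uU|->]; last exact: mem0v.
  by have /lfunP/(_ (vsproj U u)) := i0; rewrite zero_lfunE lfunE /= vsprojK.
- apply/vspaceP => v; rewrite memvf -quo_piP.
  by have /lfunP/(_ v) := p0; rewrite zero_lfunE => ->; rewrite eqxx.
Qed.

Section HomAlgebra.
Context {k : fieldType} {A : falgType k}.
Implicit Types V W X Y : fdmod A.

Lemma hom_compA V W X Y (h : modhom X Y) (g : modhom W X) (f : modhom V W) :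
  hom_comp h (hom_comp g f) = hom_comp (hom_comp h g) f.
Proof. by apply: modhom_eq; rewrite /= comp_lfunA. Qed.

Lemma hom_comp1l V W (f : modhom V W) : hom_comp (hom_id W) f = f.
Proof. by apply: modhom_eq; rewrite /= comp_lfun1l. Qed.

Lemma hom_comp1r V W (f : modhom V W) : hom_comp f (hom_id V) = f.
Proof. by apply: modhom_eq; rewrite /= comp_lfun1r. Qed.

Lemma is_iso_id V : is_iso (hom_id V).
Proof. by exists (hom_id V); rewrite hom_comp1l. Qed.

Lemma is_iso_comp V W X (g : modhom W X) (f : modhom V W) :
  is_iso g -> is_iso f -> is_iso (hom_comp g f).
Proof.
case=> g' [g'g gg'] [f' [f'f ff']]; exists (hom_comp f' g'); split.
  by rewrite -hom_compA (hom_compA g') g'g hom_comp1l.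
by rewrite -hom_compA (hom_compA f) ff' hom_comp1l.
Qed.

Lemma iso_compl_inj V W X (e : modhom W X) (f g : modhom V W) :
  is_iso e -> hom_comp e f = hom_comp e g -> f = g.
Proof.
case=> e' [e'e _] /(congr1 (hom_comp e')).
by rewrite !hom_compA e'e !hom_comp1l.
Qed.

Lemma iso_compr_inj V W X (e : modhom V W) (f g : modhom W X) :
  is_iso e -> hom_comp f e = hom_comp g e -> f = g.
Proof.
case=> e' [_ ee'] /(congr1 (fun h => hom_comp h e')).
by rewrite -!hom_compA ee' !hom_comp1r.
Qed.

Lemma hom_zero_subproof V W (a : A) :
  ((0 : 'Hom(V, W)) \o act V a = act W a \o 0)%VF.
Proof. by rewrite comp_lfun0l comp_lfun0r. Qed.
Definition hom_zero V W : modhom V W := ModHom (@hom_zero_subproof V W).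

Lemma iso_comp0l V W X (e : modhom W X) (f : modhom V W) :
  is_iso e -> hom_lfun (hom_comp e f) = 0 -> hom_lfun f = 0.
Proof.
move=> iso ef0; suff -> : f = hom_zero V W by [].
by apply: (iso_compl_inj iso); apply: modhom_eq; rewrite ef0 /= comp_lfun0r.
Qed.

Lemma iso_comp0r V W X (e : modhom V W) (f : modhom W X) :
  is_iso e -> hom_lfun (hom_comp f e) = 0 -> hom_lfun f = 0.
Proof.
move=> iso ef0; suff -> : f = hom_zero W X by [].
by apply: (iso_compr_inj iso); apply: modhom_eq; rewrite ef0 /= comp_lfun0l.
Qed.

End HomAlgebra.

(** By naturality f = eta_W G(F f) eta_V^-1, so F f determines f. *)
Lemma retract_faithful (k : fieldType) (A B : falgType k) (F : functor A B)
    (G : functor B A) :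
  nat_isomorphic (functor_comp G F) (functor_id A) ->
  forall V W, injective (@fmap k A B F V W).
Proof.
case=> eta [nat iso] V W f g fg; apply: (iso_compr_inj (iso V)).
by rewrite -[LHS]nat -[RHS]nat /= fg.
Qed.

(** * Fullness, faithfulness and simplicity under a k-linear equivalence *)

Section EquivalenceTransport.
Context {k : fieldType} {A B : falgType k} (F : functor A B).
Hypotheses (Fk : klinear F) (Feq : is_equivalence F).

Lemma equivalence_faithful V W : injective (@fmap k A B F V W).
Proof. by case: Feq => G [GF _]; apply: (retract_faithful GF). Qed.

(** The preimage is f = eta_W G(h) eta_V^-1. Naturality gives G(F f) = G(h), and G is faithful by
    the second natural isomorphism. *)
Lemma equivalence_full V W (h : modhom (F V) (F W)) : exists f, fmap F f = h.
Proof.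
case: Feq => G [[eta [nat iso]] FG].
have [e' [e'e ee']] := iso V.
exists (hom_comp (eta W) (hom_comp (fmap G h) e')).
apply: (retract_faithful FG); apply: (iso_compl_inj (iso W)).
have /= -> := nat _ _ (hom_comp (eta W) (hom_comp (fmap G h) e')).
by rewrite -!hom_compA e'e hom_comp1r.
Qed.

Lemma equivalence_ess_surj (Y : fdmod B) : exists X, exists e : modhom (F X) Y, is_iso e.
Proof.
by case: Feq => G [_ [eta [_ iso]]]; exists (G Y), (eta Y); apply: iso.
Qed.

(** Zero is preserved because it is the linear combination -1 * 0 + 0, and reflected because F is
    faithful. *)
Lemma fmap0 V W (f : modhom V W) : hom_lfun f = 0 <-> hom_lfun (fmap F f) = 0.
Proof.
have F0 : hom_lfun (fmap F (hom_zero V W)) = 0.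
  have <- : hom_lincomb (-1) (hom_zero V W) (hom_zero V W) = hom_zero V W.
    by apply: modhom_eq; rewrite /= scaler0 addr0.
  by rewrite Fk /= scaleN1r addNr.
split=> f0.
  suff -> : f = hom_zero V W by [].
  exact: modhom_eq.
suff -> : f = hom_zero V W by [].
by apply: equivalence_faithful; apply: modhom_eq; rewrite F0.
Qed.

(** The criterion [simple_modP] is transported: by essential surjectivity and fullness, a pair of
    maps through F V is, up to isomorphisms at its ends, the image of a pair through V. *)
Lemma equivalence_simple V : simple_mod V -> simple_mod (F V).
Proof.
move=> /simple_modP[nz fi]; apply/simple_modP; split.
  by rewrite -fmap_id => /fmap0.
move=> X' W' i' f' f'i'.
have [X [e isoe]] := equivalence_ess_surj X'.
have [W [d [d' [d'd dd']]]] := equivalence_ess_surj W'.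
have isod' : is_iso d' by exists d.
have [i iE] := equivalence_full (hom_comp i' e).
have [f fE] := equivalence_full (hom_comp d' f').
have [|i0|f0] := fi _ _ i f; [|left|right].
- apply/fmap0; rewrite fmap_comp iE fE; rewrite -hom_compA [hom_comp f' _]hom_compA.
  by move: f'i' => /= ->; rewrite comp_lfun0l comp_lfun0r.
- by apply: (iso_comp0r isoe); rewrite -iE -fmap0.
- by apply: (iso_comp0l isod'); rewrite -fE -fmap0.
Qed.

Lemma fmap_scalar V (f : modhom V V) c :
  (forall v, f v = c *: v) -> forall v, fmap F f v = c *: v.
Proof.
move=> fc v; have -> : f = hom_lincomb c (hom_id V) (hom_zero V V).
  by apply: modhom_eq; apply/lfunP => w; rewrite fc lfun_combE id_lfunE zero_lfunE addr0.
rewrite Fk lfun_combE fmap_id id_lfunE.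
have /fmap0 -> // : hom_lfun (hom_zero V V) = 0 by [].
by rewrite zero_lfunE addr0.
Qed.

Lemma equivalence_endo_scalar V : endo_scalar V -> endo_scalar (F V).
Proof.
move=> eV h; have [f <-] := equivalence_full h; have [c fc] := eV f.
by exists c; apply: fmap_scalar.
Qed.

End EquivalenceTransport.

(** * Self-duality pairings and the trace of the antipode *)

Section Trace.
Context {k : fieldType} {V : vectType k}.

Lemma lfun_traceE (f : 'End(V)) : lfun_trace f = \sum_i bcoord i (f (bvec i)).
Proof.
rewrite /lfun_trace /mxtrace; apply: eq_bigr => i _.
by rewrite !mxE /= passmx.vecof_delta.
Qed.

(** The identity is the sum of the rank one maps v |-> x_i(v) u_i, and composing f with the i-th one
    gives trace x_i(f u_i). This allows [gamma_pairing] to compute on H / ann V with lifts of matrix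
    units. *)
Lemma lfun_trace_frame (I : finType) (u : I -> V) (x : I -> V -> k) (f : 'End(V)) :
  (forall i, scalar (x i)) -> (forall v, v = \sum_i x i v *: u i) ->
  lfun_trace f = \sum_i x i (f (u i)).
Proof.
move=> xL frame; rewrite lfun_traceE.
transitivity (\sum_m \sum_i x i (bvec m) * bcoord m (f (u i))).
  apply: eq_bigr => m _; rewrite {1}[bvec m]frame linear_sum.
  rewrite /bcoord linear_sum; apply: eq_bigr => i _.
  by rewrite !linearZ.
rewrite exchange_big; apply: eq_bigr => i _ /=.
have xL' : @GRing.linear_for k V k^o *:%R (x i) by exact: xL.
rewrite [f (u i) in RHS]bcoord_sum (linfun_sum xL'); apply: eq_bigr => m _.
by rewrite (linfunZ xL') mulrC.
Qed.

End Trace.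

Lemma tlift_sum (k : fieldType) (U V W : vectType k) (I : finType) (f : I -> U -> V -> W) t :
  \sum_i tlift (f i) t = tlift (fun u v => \sum_i f i u v) t.
Proof.
under eq_bigr do rewrite mklinE /tlift_fun.
rewrite mklinE /tlift_fun exchange_big; apply: eq_bigr => p _.
by rewrite exchange_big; apply: eq_bigr => q _; rewrite scaler_sumr.
Qed.

Section Pairings.
Context {k : fieldType} {H : hopfAlg k}.
Implicit Types V : fdmod H.
Local Notation D := (comul H).
Local Notation e := (counit H).
Local Notation S := (antipode H).

(* One of the two zigzag identities suffices: for the matrices C of c(1) and B
   of b it reads C B = 1, which implies B C = 1. *)
Definition zigzag V (b : modhom (tens_mod V V) (unit_mod H))
    (c : modhom (unit_mod H) (tens_mod V V)) : Prop :=
  hom_comp (hom_runit V) (hom_comp (tens_hom (hom_id V) b)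
    (hom_comp (hom_assoc V V V) (tens_hom c (hom_id V)))) = hom_lunit V.

(** The map (id (x) b)(t (x) v), which for t = c(1) is the value of the zigzag on 1 (x) v. *)
Definition contract (V : vectType k) (b : 'Hom(tens V V, k^o)) (t : tens V V) (v : V) : V :=
  tlift (fun x y => (b (y ⊗ v) : k) *: x) t.

Lemma contract_bilinear (V : vectType k) (b : 'Hom(tens V V, k^o)) (v : V) :
  bilinear_fun (fun x y : V => (b (y ⊗ v) : k) *: x).
Proof.
split=> [x|y] c p q; first by rewrite pureDZl linearP scalerDl scalerA.
by rewrite scalerDr !scalerA mulrC.
Qed.

Lemma contractE (V : vectType k) (b : 'Hom(tens V V, k^o)) (t : tens V V) v :
  trunit V (tmap \1 b (tassoc V V V (t ⊗ v))) = contract b t v.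
Proof.
move: t; apply: tens_fun_ext => [c p q|c p q|x y].
- by rewrite pureDZl !linearP.
- by rewrite /contract linearP.
rewrite tassocE tmapE trunitE /contract tliftE ?id_lfunE //.
exact: contract_bilinear.
Qed.

Lemma zigzagP V b c : @zigzag V b c <-> forall v, contract b (c 1) v = v.
Proof.
have E (a : k^o) v : hom_comp (hom_runit V) (hom_comp (tens_hom (hom_id V) b)
    (hom_comp (hom_assoc V V V) (tens_hom c (hom_id V)))) (a ⊗ v) =
    (a : k) *: contract b (c 1) v.
  rewrite /= !comp_lfunE tmapE id_lfunE contractE.
  have -> : c a = (a : k) *: c 1 by rewrite -linearZ -[in LHS](mulr1 a).
  by rewrite /contract linearZ.
split=> [Z v|Z]; first by have := E 1 v; rewrite Z tlunitE !scale1r.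
apply: modhom_eq; apply: tens_ext => a v.
by rewrite [LHS]E Z tlunitE.
Qed.

Lemma unit_actv (a : H) (x : k^o) : act (unit_mod H) a x = (e a : k) *: x.
Proof. by rewrite unit_actE scale_lfunE id_lfunE. Qed.

(* b(hv, w) = b(h1 v, h2 S(h3) w) = b(v, S(h) w) in Sweedler notation *)
Lemma pairing_adjoint V (b : modhom (tens_mod V V) (unit_mod H)) a v w :
  b (act V a v ⊗ w) = b (v ⊗ act V (S a) w).
Proof.
pose g a1 a2 a3 : k^o := b (act V a1 v ⊗ act V a2 (act V (S a3) w)).
have := @comulA3 _ H k^o g a.
rewrite /g => E; transitivity (tlift (fun x y => tlift (fun y z => g x y z) (D y)) (D a)).
  rewrite -(counitrE (f := fun x => b (act V x v ⊗ w))); last first.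
    by move=> c p q; rewrite act_scal pureDZl linearP.
  congr (fun_of_lfun _ _); apply: tlift_eq => x y.
  have L : linear (fun t => b (act V x v ⊗ act V t w)).
    by move=> c p q; rewrite act_scal pureDZr linearP.
  transitivity (b (act V x v ⊗ act V (tlift (fun p q => p * S q) (D y)) w)).
    by rewrite antipoder (linfunZ L) act1 id_lfunE.
  rewrite (tlift_comp _ L); congr (fun_of_lfun _ _); apply: tlift_eq => p q.
  by rewrite /g actM comp_lfunE.
rewrite -E.
- rewrite -(counitlE (f := fun z => b (v ⊗ act V (S z) w))); last first.
    by move=> c p q; rewrite linearP act_scal pureDZr linearP.
  congr (fun_of_lfun _ _); apply: tlift_eq => x z.
  have := modhomE b x (v ⊗ act V (S z) w).
  rewrite unit_actv tens_modE (tlift_comp _ (L := b)) // => c p q.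
  by rewrite linearP.
- by move=> y z c p q; rewrite act_scal pureDZl linearP.
- by move=> x z c p q; rewrite act_scal pureDZr linearP.
- by move=> x y c p q; rewrite linearP act_scal linearP pureDZr linearP.
Qed.

Lemma contract_sum (V : vectType k) (b : 'Hom(tens V V, k^o)) (t : tens V V) v :
  contract b t v = \sum_i \sum_j (t i j * (b (bvec j ⊗ v) : k)) *: bvec i.
Proof.
rewrite /contract mklinE /tlift_fun; apply: eq_bigr => i _.
by apply: eq_bigr => j _; rewrite scalerA.
Qed.

(** At v = [bvec j] this is the (i, j) entry of the product of the matrix t with the Gram matrix of
    b. *)
Lemma bcoord_contract (V : vectType k) (b : 'Hom(tens V V, k^o)) (t : tens V V) v i :
  bcoord i (contract b t v) = \sum_j t i j * (b (bvec j ⊗ v) : k).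
Proof.
have L : @GRing.linear_for k V k^o *:%R (bcoord i) by exact: bcoord_linear.
rewrite contract_sum (linfun_sum L) (bigD1 i) //= (linfun_sum L) [X in _ + X]big1 ?addr0.
  by apply: eq_bigr => j _; rewrite (linfunZ L) bcoord_bvec eqxx; apply: mulr1.
move=> i' ni; rewrite (linfun_sum L) big1 // => j _.
by rewrite (linfunZ L) bcoord_bvec (negPf ni); apply: mulr0.
Qed.

(** The isomorphism is v |-> b(v, -), a module map by [pairing_adjoint], with inverse psi |-> (psi
    (x) id)(c(1)). One composite is the identity by the zigzag itself, the other by the matrix
    identity B C = 1. *)
Lemma pairing_self_dual V b c : @zigzag V b c -> self_dual V.
Proof.
move/zigzagP => Z.
have fL v : linear (fun w => b (v ⊗ w)) by move=> a p q; rewrite pureDZr linearP.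
have FL : linear (fun v => mklin (fL v) : dual_mod V).
  by move=> a p q; apply/lfunP => w; rewrite lfun_combE !mklinE pureDZl linearP.
pose f := mklin FL; have fE v w : f v w = b (v ⊗ w) by rewrite /f !mklinE.
have fH a v : f (act V a v) = act (dual_mod V) a (f v).
  by apply/lfunP => w; rewrite fE [RHS]dual_actE fE pairing_adjoint.
pose C := c 1 : tens V V.
pose gf (psi : 'Hom(V, k^o)) : V := \sum_m (\sum_p C p m * (psi (bvec p) : k)) *: bvec m.
have gL : linear gf.
  move=> a x y; rewrite /gf scaler_sumr -big_split; apply: eq_bigr => m _ /=.
  rewrite scalerA -scalerDl mulr_sumr -big_split; congr (_ *: _); apply: eq_bigr => p _ /=.
  by rewrite lfun_combE mulrDr mulrCA.
have fg psi : f (gf psi) = psi.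
  apply/lfunP => w; rewrite fE.
  have L : linear (fun x => b (x ⊗ w)) by move=> a p q; rewrite pureDZl linearP.
  rewrite (linfun_sum L) -[w in RHS]Z contract_sum linear_sum.
  transitivity (\sum_m \sum_p C p m * (psi (bvec p) : k) * (b (bvec m ⊗ w) : k)).
    by apply: eq_bigr => m _; rewrite (linfunZ L); apply: mulr_suml.
  rewrite exchange_big; apply: eq_bigr => p _; rewrite linear_sum.
  by apply: eq_bigr => m _; rewrite linearZ /= mulrAC.
pose B : 'M[k]_(\dim {:V}) := \matrix_(i, j) b (bvec i ⊗ bvec j).
have BC : B *m (C : 'M_(_, _)) = 1%:M.
  apply: mulmx1C; apply/matrixP => i j; rewrite !mxE.
  have := bcoord_contract b C (bvec j) i; rewrite Z bcoord_bvec eq_sym => ->.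
  by apply: eq_bigr => m _; rewrite mxE.
have gfK v : gf (f v) = v.
  have L : linear (fun v => gf (f v)) by move=> a p q; rewrite linearP gL.
  rewrite [v in LHS]bcoord_sum (linfun_sum L) [RHS]bcoord_sum; apply: eq_bigr => l _.
  rewrite (linfunZ L); congr (_ *: _); rewrite /gf (bigD1 l) //= [X in _ + X]big1 => [|m ml].
      rewrite addr0 -[RHS]scale1r; congr (_ *: _).
    have /matrixP/(_ l l) := BC; rewrite !mxE eqxx mulr1n => <-.
    by apply: eq_bigr => p _; rewrite fE mxE mulrC.
  have /matrixP/(_ l m) := BC; rewrite !mxE eq_sym (negPf ml) mulr0n => E0.
  rewrite (_ : \sum_p _ = 0) ?scale0r // -[RHS]E0.
  by apply: eq_bigr => p _; rewrite fE mxE mulrC.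
have gH a x : mklin gL (act (dual_mod V) a x) = act V a (mklin gL x).
  have -> : act (dual_mod V) a x = f (act V a (gf x)) by rewrite fH fg.
  by rewrite (mklinE gL) gfK (mklinE gL).
exists (ModHom (modhom_subproof fH)), (ModHom (modhom_subproof (V := dual_mod V) gH)).
split; apply: modhom_eq; apply/lfunP => x; rewrite [LHS]comp_lfunE id_lfunE.
  by rewrite [LHS](mklinE gL) gfK.
by rewrite /= (mklinE gL) fg.
Qed.

(** Evaluation and coevaluation are carried along the isomorphism f with inverse g: b(v, w) =
    f(v)(w) and c(1) = sum_i e_i (x) g(e^i). Equivariance of b is the antipode law for S(h1) h2,
    that of c the law for h1 S(h2). *)
Lemma self_dual_pairing V : self_dual V -> exists b c, @zigzag V b c.
Proof.
case=> f [g [gf fg]].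
have fgE (x : 'Hom(V, k^o)) : f (g x) = x.
  by have /(congr1 (fun u : modhom (dual_mod V) (dual_mod V) => u x)) := fg; rewrite /= comp_lfunE id_lfunE.
have bB : bilinear_fun (fun v w => (f v : 'Hom(V, k^o)) w).
  split=> u a p q; first by rewrite linearP.
  by rewrite linearP lfun_combE.
pose b : 'Hom(tens V V, k^o) := tlift (fun v w => (f v : 'Hom(V, k^o)) w).
have bE v w : b (v ⊗ w) = (f v : 'Hom(V, k^o)) w by rewrite /b tliftE.
have bH a t : b (act (tens_mod V V) a t) = act (unit_mod H) a (b t).
  move: t; apply: tens_fun_ext => [c p q|c p q|v w]; try by rewrite !linearP.
  rewrite tens_modE tlift_comp; last by move=> c p q; rewrite linearP.
  have L : linear (fun t => (f v : 'Hom(V, k^o)) (act V t w)).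
    by move=> c p q; rewrite act_scal linearP.
  rewrite unit_actv bE.
  transitivity ((f v : 'Hom(V, k^o)) (act V (tlift (fun x y => S x * y) (D a)) w)).
    rewrite (tlift_comp _ L); congr (fun_of_lfun _ _); apply: tlift_eq => x y.
    by rewrite bE modhomE [LHS]dual_actE actM comp_lfunE.
  by rewrite antipodel (linfunZ L) act1 id_lfunE.
pose x i : 'Hom(V, k^o) := mklin (@bcoord_linear k V i : @GRing.linear_for k V k^o *:%R (bcoord i)).
(* The identification of End(V) with V (x) V^*, followed by g on the second factor; c(1) will be [P]
   of the identity. *)
pose P (th : 'End(V)) : tens V V := \sum_i th (bvec i) ⊗ g (x i).
have PL : linear P.
  move=> a p q; rewrite /P scaler_sumr -big_split; apply: eq_bigr => i _ /=.
  by rewrite lfun_combE pureDZl.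
(* The canonical tensor sum_i e_i (x) e^i lets an endomorphism move from the functionals to the
   vectors. *)
have PC (th eta : 'End(V)) : \sum_i th (bvec i) ⊗ g (x i \o eta)%VF = P (th \o eta)%VF.
  transitivity (\sum_i \sum_j (bcoord i (eta (bvec j))) *: (th (bvec i) ⊗ g (x j))).
    apply: eq_bigr => i _.
    have L : linear (fun y => th (bvec i) ⊗ g y) by move=> a p q; rewrite linearP pureDZr.
    have -> : (x i \o eta)%VF = \sum_j bcoord i (eta (bvec j)) *: x j.
      apply/lfunP => v; rewrite comp_lfunE mklinE [v in LHS]bcoord_sum linear_sum.
      rewrite sum_lfunE /bcoord linear_sum; apply: eq_bigr => j _.
      by rewrite !linearZ scale_lfunE mklinE /= mulrC.
    by rewrite (linfun_sum L); apply: eq_bigr => j _; rewrite (linfunZ L).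
  rewrite exchange_big; apply: eq_bigr => j _ /=.
  have L : linear (fun y => th y ⊗ g (x j)) by move=> a p q; rewrite linearP pureDZl.
  rewrite comp_lfunE [eta _ in RHS]bcoord_sum (linfun_sum L).
  by apply: eq_bigr => i _; rewrite (linfunZ L).
(* h c(1) = sum_i h1 e_i (x) h2 g(e^i) = P(h1 S(h2)) = e(h) P(1) *)
have cL : linear (fun a : k^o => (a : k) *: P \1%VF).
  by move=> a p q; rewrite scalerDl scalerA.
have cH a s : mklin cL (act (unit_mod H) a s) = act (tens_mod V V) a (mklin cL s).
  rewrite !(mklinE cL) unit_actv linearZ /= -[(_ *: s : k^o)]/((e a : k) * (s : k)) mulrC -scalerA; congr (_ *: _).
  rewrite [in RHS]/P (linear_sum (act (tens_mod V V) a)).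
  have -> : (e a : k) *: P \1%VF = P (act V (tlift (fun x y => x * S y) (D a))).
    by rewrite antipoder linearZ /= act1 (linfunZ PL).
  have L : linear (fun t => P (act V t)) by move=> c p q; rewrite linearP PL.
  rewrite (tlift_comp _ L).
  transitivity (\sum_i tlift (fun a1 a2 => act V a1 (bvec i) ⊗ g (x i \o act V (S a2))%VF) (D a)); last first.
    apply: eq_bigr => i _.
    transitivity (act (tens_mod V V) a (bvec i ⊗ g (x i))); last by rewrite id_lfunE.
    rewrite tens_modE; congr (fun_of_lfun _ _).
    apply: tlift_eq => a1 a2; rewrite -modhomE; congr (_ ⊗ g _).
    by apply/lfunP => v; rewrite [RHS]dual_actE comp_lfunE.
  rewrite tlift_sum; congr (fun_of_lfun _ _); apply: tlift_eq => a1 a2.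
  by rewrite PC -actM.
exists (ModHom (modhom_subproof (V := tens_mod V V) (W := unit_mod H) bH)).
exists (ModHom (modhom_subproof (V := unit_mod H) (W := tens_mod V V) cH)).
apply/zigzagP => v; rewrite (mklinE cL) scale1r /P /contract linear_sum.
rewrite [RHS]bcoord_sum; apply: eq_bigr => i _; rewrite id_lfunE.
transitivity (tlift (fun p q => (b (q ⊗ v) : k) *: p) (bvec i ⊗ g (x i))) => //.
rewrite tliftE; last exact: contract_bilinear.
by rewrite bE fgE /x mklinE.
Qed.

(** The representative picked by [vsval] differs from a by an element of the annihilator. *)
Lemma quo_act V (a : H) : act V (vsval (quo_pi (ann V) a)) = act V a.
Proof.
apply/eqP; rewrite -subr_eq0 -linearB -memv_ker -/(ann V) -quo_piP linearB /=.
by rewrite quo_pi_surj subrr.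
Qed.

(* With E_ij = act (h_ij) the matrix units, the classes of the h_ij form a basis
   of H / ann V, and S h_ij acts as the b-adjoint of E_ij; so the trace is
   \sum_ij C_ij B_ij for the matrices C of c(1) and B of b, i.e. b(c(1)). *)
Lemma gamma_pairing V b c :
  (forall g : 'End(V), exists a, act V a = g) -> @zigzag V b c -> gamma V = b (c 1).
Proof.
move=> dV Z; have sd := pairing_self_dual Z; move/zigzagP: Z => Z.
rewrite /gamma asboolT //.
have elem (i j : 'I_(\dim {:V})) : exists a, forall l, act V a (bvec l) = (l == j)%:R *: bvec i.
  have L : linear (fun v : V => bcoord j v *: (bvec i : V)).
    by move=> a p q; rewrite bcoord_linear scalerDl scalerA.
  have [a aE] := dV (mklin L); exists a => l.
  by rewrite aE mklinE bcoord_bvec.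
pose h (p : 'I_(\dim {:V}) * 'I_(\dim {:V})) : H := sval (cid (elem p.1 p.2)).
have hE p l : act V (h p) (bvec l) = (l == p.2)%:R *: bvec p.1 by rewrite /h; case: cid.
(* The coordinates dual to the classes of the h_ij are the matrix entries of the action; they
   determine a class, since elements acting equally agree modulo ann V. *)
pose x (p : 'I_(\dim {:V}) * 'I_(\dim {:V})) (q : quo (ann V)) : k :=
  bcoord p.1 (act V (vsval q) (bvec p.2)).
rewrite (@lfun_trace_frame _ _ _ (fun p => quo_pi (ann V) (h p)) x); last first.
- move=> q; under eq_bigr do rewrite -linearZ; rewrite -linear_sum -{1}[q]quo_pi_surj; apply/eqP.
  rewrite -subr_eq0 -linearB quo_piP memv_ker linearB subr_eq0 /=; apply/eqP/lfun_bvecP => l.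
  rewrite linear_sum sum_lfunE.
  transitivity (\sum_i \sum_j x (i, j) q *: act V (h (i, j)) (bvec l)); last first.
    rewrite pair_bigA; apply: eq_bigr => -[i j] _.
    by rewrite linearZ scale_lfunE.
  rewrite [LHS]bcoord_sum; apply: eq_bigr => i _.
  rewrite (bigD1 l) //= big1 ?addr0; first by rewrite hE eqxx scale1r.
  by move=> j jl; rewrite hE eq_sym (negPf jl) scale0r scaler0.
- move=> p a q r; rewrite /x.
  have -> : vsval (a *: q + r) = a *: vsval q + vsval r by rewrite linearP.
  by rewrite act_scal bcoord_linear.
transitivity (\sum_i \sum_j (c 1 : tens V V) i j * (b (bvec i ⊗ bvec j) : k)); last first.
  rewrite {2}[c 1]tens_sum linear_sum; apply: eq_bigr => i _.
  by rewrite linear_sum; apply: eq_bigr => j _; rewrite linearZ.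
rewrite pair_bigA; apply: eq_bigr => -[i j] _ /=.
rewrite quo_mapE ?antipode_ann // /x quo_act /=.
(* The zigzag expands the i-th coordinate of S(h_ij) e_j as sum_m C_im b(e_m, S(h_ij) e_j) = sum_m
   C_im b(h_ij e_m, e_j). Only m = j survives, leaving C_ij B_ij. *)
rewrite -[act V (antipode H (h (i, j))) (bvec j)]Z bcoord_contract (bigD1 j) //= big1 => [|m mj].
  by rewrite addr0 -pairing_adjoint hE eqxx scale1r.
have L : linear (fun y => b (y ⊗ bvec j)) by move=> a p q; rewrite pureDZl linearP.
by rewrite -pairing_adjoint hE (negPf mj) (linfunZ L) scale0r mulr0.
Qed.

End Pairings.

(** * Transport along a tensor equivalence *)

Section Isos.
Context {k : fieldType} {H : hopfAlg k}.
Implicit Types V W X : fdmod H.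

Lemma tens_hom_comp V V' V'' W W' W'' (f' : modhom V' V'') (f : modhom V V')
    (g' : modhom W' W'') (g : modhom W W') :
  tens_hom (hom_comp f' f) (hom_comp g' g) = hom_comp (tens_hom f' g') (tens_hom f g).
Proof.
apply: modhom_eq; apply: tens_ext => v w.
by rewrite /= (comp_lfunE (tmap _ _)) !tmapE !comp_lfunE.
Qed.

Lemma tens_hom_id V W : tens_hom (hom_id V) (hom_id W) = hom_id (tens_mod V W).
Proof. by apply: modhom_eq; apply: tens_ext => v w; rewrite tmapE !id_lfunE. Qed.

Lemma is_iso_tens V V' W W' (f : modhom V V') (g : modhom W W') :
  is_iso f -> is_iso g -> is_iso (tens_hom f g).
Proof.
case=> f' [f'f ff'] [g' [g'g gg']]; exists (tens_hom f' g').
by rewrite -!tens_hom_comp f'f ff' g'g gg' !tens_hom_id.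
Qed.

End Isos.

Section Transport.
Context {k : fieldType} {H H' : hopfAlg k} (F : tensor_equivalence H H') (V : fdmod H).
Variables (b : modhom (tens_mod V V) (unit_mod H)) (c : modhom (unit_mod H) (tens_mod V V)).
Variables (b' : modhom (tens_mod (F V) (F V)) (unit_mod H'))
          (c' : modhom (unit_mod H') (tens_mod (F V) (F V))).
(** Relating the pairs by equations serves both directions: (b', c') can be built from (b, c), or
    (b, c) obtained from (b', c') by fullness. *)
Hypothesis bb' : hom_comp (teq_phi F) b' = hom_comp (fmap F b) (teq_J F V V).
Hypothesis cc' : hom_comp (teq_J F V V) c' = hom_comp (fmap F c) (teq_phi F).
Local Notation J := (teq_J F).
Local Notation phi := (teq_phi F).

(** Naturality of J pulls F through the two tensor products, and the associativity and right unit
    axioms of F replace the images of the structure maps. *)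
Lemma fmap_zigzag :
  hom_comp (fmap F (hom_comp (hom_runit V) (hom_comp (tens_hom (hom_id V) b)
      (hom_comp (hom_assoc V V V) (tens_hom c (hom_id V))))))
    (hom_comp (J (unit_mod H) V) (tens_hom phi (hom_id (F V)))) =
  hom_comp (hom_runit (F V)) (hom_comp (tens_hom (hom_id (F V)) b')
    (hom_comp (hom_assoc (F V) (F V) (F V)) (tens_hom c' (hom_id (F V))))).
Proof.
have Ec : hom_comp (fmap F (tens_hom c (hom_id V)))
    (hom_comp (J (unit_mod H) V) (tens_hom phi (hom_id (F V)))) =
  hom_comp (J (tens_mod V V) V) (hom_comp (tens_hom (J V V) (hom_id (F V)))
    (tens_hom c' (hom_id (F V)))).
  by rewrite hom_compA -teq_J_natural -hom_compA fmap_id -!tens_hom_comp cc'.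
have Eb : hom_comp (fmap F (tens_hom (hom_id V) b))
    (hom_comp (J V (tens_mod V V)) (tens_hom (hom_id (F V)) (J V V))) =
  hom_comp (J V (unit_mod H)) (hom_comp (tens_hom (hom_id (F V)) phi)
    (tens_hom (hom_id (F V)) b')).
  by rewrite hom_compA -teq_J_natural -hom_compA fmap_id -!tens_hom_comp bb'.
rewrite !fmap_comp -!hom_compA Ec.
rewrite (hom_compA (J (tens_mod V V) V)) (hom_compA (fmap F (hom_assoc V V V))) teq_assoc.
rewrite -(teq_runit F V) -!hom_compA; congr (hom_comp _ _).
by rewrite !hom_compA -(hom_compA (fmap F (tens_hom (hom_id V) b))) Eb -!hom_compA.
Qed.

(** The left unit axiom gives the right-hand side of the zigzag the same form as [fmap_zigzag].
    Backwards, the isomorphism 1 (x) F V -> F(1 (x) V) is cancelled and F is faithful. *)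
Lemma zigzag_transport : zigzag b c <-> zigzag b' c'.
Proof.
have isoJ : is_iso (hom_comp (J (unit_mod H) V) (tens_hom phi (hom_id (F V)))).
  apply: is_iso_comp; first exact: teq_J_iso.
  by apply: is_iso_tens; [exact: teq_phi_iso | exact: is_iso_id].
rewrite /zigzag -fmap_zigzag -teq_lunit; split=> [->//|].
by move/(iso_compr_inj isoJ)/(equivalence_faithful (teq_equivalence F)).
Qed.

(** The composite b c is multiplication by [b (c 1)] on the unit module. F preserves scalars, and
    phi b' c' = F(b c) phi. *)
Lemma pairing_value_transport : b (c 1) = b' (c' 1).
Proof.
have [psi [psiphi _]] := teq_phi_iso F.
have phiK x : psi (phi x) = x.
  by have /(congr1 (fun u : modhom (unit_mod H') (unit_mod H') => u x)) := psiphi; rewrite /= comp_lfunE id_lfunE.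
have bcE (x : unit_mod H) : hom_comp b c x = (b (c 1) : k) *: x.
  rewrite [LHS]comp_lfunE -{1}[x]mulr1 -[x * 1]/((x : k) *: (1 : k^o)) !linearZ /=.
  exact: mulrC.
apply: (can_inj phiK).
have -> : phi (b' (c' 1)) = fmap F (hom_comp b c) (phi 1).
  have -> : phi (b' (c' 1)) = hom_comp (hom_comp phi b') c' 1 by rewrite /= !comp_lfunE.
  by rewrite bb' -hom_compA cc' hom_compA -fmap_comp /= comp_lfunE.
rewrite (fmap_scalar (teq_klinear F) (teq_equivalence F) bcE) -linearZ; congr (phi _).
by rewrite -[LHS]mulr1.
Qed.

End Transport.

Theorem theorem4p1 (k : fieldType) (H H' : hopfAlg k)
    (F : tensor_equivalence H H') (V : fdmod H) :
  absolutely_simple V -> gamma V = gamma (F V).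
Proof.
move=> aV; have sV := aV.1; have eV := absolutely_simple_endo aV.
have Feq := teq_equivalence F; have Fk := teq_klinear F.
have sFV := equivalence_simple Fk Feq sV.
have eFV := equivalence_endo_scalar Fk Feq eV.
have [J' [J'J JJ']] := teq_J_iso F V V.
have [psi [psiphi phipsi]] := teq_phi_iso F.
have [/self_dual_pairing[b [c Z]]|nsV] := EM (self_dual V).
  pose b' := hom_comp psi (hom_comp (fmap F b) (teq_J F V V)).
  pose c' := hom_comp J' (hom_comp (fmap F c) (teq_phi F)).
  have bb' : hom_comp (teq_phi F) b' = hom_comp (fmap F b) (teq_J F V V).
    by rewrite hom_compA phipsi hom_comp1l.
  have cc' : hom_comp (teq_J F V V) c' = hom_comp (fmap F c) (teq_phi F).
    by rewrite hom_compA JJ' hom_comp1l.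
  have Z' := (zigzag_transport bb' cc').1 Z.
  rewrite (gamma_pairing (density sV eV) Z) (gamma_pairing (density sFV eFV) Z').
  exact: pairing_value_transport bb' cc'.
have nsFV : ~ self_dual (F V).
  (* A zigzag pair on F V, conjugated by J and phi, lifts through the full functor F and would make
     V self-dual. *)
  move=> /self_dual_pairing[b' [c' Z']]; apply: nsV.
  have [b bE] := equivalence_full Feq (hom_comp (teq_phi F) (hom_comp b' J')).
  have [c cE] := equivalence_full Feq (hom_comp (teq_J F V V) (hom_comp c' psi)).
  suff E : zigzag b c <-> zigzag b' c' by exact: pairing_self_dual (E.2 Z').
  apply: zigzag_transport.
    by rewrite bE -!hom_compA J'J hom_comp1r.
  by rewrite cE -!hom_compA psiphi hom_comp1r.
by rewrite /gamma !asboolF.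
Qed.
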